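(* Work in type $A_4$. Let $\mathbf{i},\mathbf{i}'$ be reduced expressions for $w_0$. Their commutation classes $[\mathbf{i}],[\mathbf{i}']$ are adjacent if and only if the simplicial regions $X_{\mathbf{i}},X_{\mathbf{i}'}$ are adjacent.
   Context: **Weyl group.** $W=S_5$ is the Weyl group of type $A_4$, with Coxeter generators $s_p=(p\ p{+}1)$, $p=1,\dots,4$, and longest element $w_0$ (length $10$). A reduced expression $\mathbf{i}=(i_1,\dots,i_{10})$ is identified with $s_{i_1}\cdots s_{i_{10}}=w_0$. The commutation class $[\mathbf{i}]$ is the set of reduced expressions obtained from $\mathbf{i}$ by sequences of commutations $s_ps_q=s_qs_p$, $|p-q|>1$. **Adjacency of classes.** Two commutation classes are adjacent if there exist reduced expressions in these classes one of which is obtained from the other by applying one long braid relation (replacing consecutive letters $p,q,p$ by $q,p,q$, where $|p-q|=1$). **Chamber sets.** For each pair $s<s'$ of positions of consecutive occurrences of a letter $p$ in $\mathbf{i}$ (i.e. $i_s=i_{s'}=p$ and $i_r\ne p$ for $s<r<s'$) there is a bounded chamber in the chamber diagram (pseudo-line arrangement) of $\mathbf{i}$; its chamber set is the set of labels of strings passing below it, namely $\{s_{i_1}s_{i_2}\cdots s_{i_s}(m): p<m\le 5\}$. There are $6$ bounded chambers. **Partial quivers.** A partial quiver $P$ of type $A_4$ is a word of length $3$ in the symbols $L,R,-$ (edges of the Dynkin diagram from left to right, numbered $4,3,2$; $-$ means undirected) in which the directed edges form a nonempty connected string. Put $l_1(P)=\{j: \text{edge } j \text{ is } L\}$; $l_2(P)=[1,i-1]$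 if the rightmost directed edge is an $R$ at edge $i$, else $\emptyset$; $l_3(P)=[j+1,5]$ if the leftmost directed edge is an $R$ at edge $j$, else $\emptyset$; and $l(P)=l_1(P)\cup l_2(P)\cup l_3(P)$. The map $l$ is a bijection from partial quivers to all chamber sets. $\mathcal{P}(\mathbf{i})$ is the set of the $6$ partial quivers $P$ such that $l(P)$ is a chamber set of $\mathbf{i}$. **Vectors** ($P$; $l(P)$; $v_P$): $LLL$; $234$; $(1,0,0,0,0,0,0,0,0,0)$. $LLR$; $134$; $(0,0,1,0,0,0,0,0,1,0)$. $LRL$; $24$; $(1,1,0,0,0,0,1,1,0,0)$. $RLL$; $235$; $(1,0,0,1,0,0,0,0,0,1)$. $LRR$; $14$; $(0,1,0,0,0,0,0,1,1,0)$. $RLR$; $135$; $(0,0,1,1,0,0,0,0,1,1)$. $RRL$; $25$; $(1,0,0,0,0,0,1,0,0,0)$. $RRR$; $15$; $(0,0,0,0,0,0,0,0,1,0)$. $LL-$; $34$; $(0,0,0,0,0,0,0,1,0,0)$. $LR-$; $124$; $(0,1,0,0,0,1,0,0,0,0)$. $RL-$; $35$; $(0,0,0,0,0,1,0,0,0,1)$. $RR-$; $125$; $(0,0,0,1,0,0,0,0,0,0)$. $-LL$; $23$; $(1,0,0,0,0,0,0,0,0,1)$. $-LR$; $13$; $(0,0,1,0,0,0,0,0,1,1)$. $-RL$; $245$; $(1,1,0,0,0,0,1,0,0,0)$. $-RR$; $145$; $(0,1,0,0,0,0,0,0,1,0)$. $L--$; $4$; $(0,1,0,0,0,0,0,1,0,0)$.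 $R--$; $1235$; $(0,0,0,1,0,0,0,0,0,1)$. $-L-$; $3$; $(0,0,1,0,0,0,0,0,0,1)$. $-R-$; $1245$; $(0,1,0,0,0,0,1,0,0,0)$. $--L$; $2$; $(1,0,0,0,1,0,0,0,0,0)$. $--R$; $1345$; $(0,0,0,0,1,0,0,0,1,0)$. Also $v_1=(1,0,0,0,1,0,0,0,1,0)$, $v_2=(0,0,1,0,0,0,1,0,0,0)$, $v_3=(0,1,0,0,0,1,0,0,0,1)$, $v_4=(0,0,0,1,0,0,0,1,0,0)$. **The function $R$ and simplicial regions.** Let $\mathbf{j}=(1,3,2,4,1,3,2,4,1,3)$ and $\mathbf{j}'=(2,4,1,3,2,4,1,3,2,4)$. Lusztig's piecewise-linear function $R=R_{\mathbf{j}}^{\mathbf{j}'}:\mathbb{R}^{10}\to\mathbb{R}^{10}$ is obtained by choosing a sequence of reduced expressions from $\mathbf{j}$ to $\mathbf{j}'$ in which consecutive ones differ by a braid relation and composing the corresponding maps (the result is independent of the choice): when $s_ps_q$ is replaced by $s_qs_p$ ($|p-q|>1$), the corresponding consecutive coordinates $(a,b)$ become $(b,a)$; when $s_ps_qs_p$ is replaced by $s_qs_ps_q$ ($|p-q|=1$), the corresponding consecutive coordinates $(a,b,c)$ become $(b+c-a,a,b)$ if $a\le c$ and $(b,c,b+a-c)$ if $a\ge c$. A region of linearity of $R$ is a set of the form: closure of the interior of $\{v: R(v)=\Lambda(v)\}$, where $\Lambda$ is a linear map for which this interior is nonempty; each region of linearity is a convex polyhedral cone. The minimum number of linear inequalities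 needed to define a region of linearity in $\mathbb{R}^{10}$ is $6$. A simplicial region is a set $X\cap\mathbb{R}_{\ge0}^{10}$, where $X$ is a region of linearity of $R$ defined by exactly $6$ irredundant linear inequalities. Each simplicial region has exactly $10$ walls (the hyperplanes in $\mathbb{R}^{10}$ spanned by its facets). $\mathcal{W}$ is the set of all hyperplanes in $\mathbb{R}^{10}$ which arise as walls of simplicial regions. **The region $X_{\mathbf{i}}$.** For each of the $10$ vectors $v_P$ ($P\in\mathcal{P}(\mathbf{i})$), $v_j$ ($1\le j\le 4$) there is a unique $W\in\mathcal{W}$ containing the other $9$; the $10$ hyperplanes so obtained are the walls of a simplicial region, denoted $X_{\mathbf{i}}$, and the $10$ vectors all lie in $X_{\mathbf{i}}$. The map $[\mathbf{i}]\mapsto X_{\mathbf{i}}$ is a bijection from commutation classes to simplicial regions. **Adjacency of regions.** Two (distinct) simplicial regions are adjacent if they have a common wall, with equation $Q=0$ ($Q$ a linear form), and there is a bijection between their remaining $9$ walls such that corresponding walls have equations $Q_i=0$ and $Q_i+\lambda_iQ=0$ for some linear forms $Q_i$ and some $\lambda_i\in\mathbb{R}$, $i=1,\dots,9$. *)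

(* Defs.v *)
From Stdlib Require Import Relations.
From mathcomp Require Import all_boot all_order all_algebra all_fingroup.
From mathcomp Require Import boolp classical_sets functions reals.
From mathcomp Require Import topology normedtype.

Set Implicit Arguments.
Unset Strict Implicit.
Unset Printing Implicit Defensive.

Import Order.TTheory GRing.Theory Num.Theory.
Import numFieldNormedType.Exports.

Local Open Scope classical_set_scope.
Local Open Scope ring_scope.

(* Letters are the naturals 1..4 and string labels the naturals 1..5; the label
   m is carried by the element m - 1 of 'I_5.  Positions in a word count
   from 0. *)
Definition word := seq nat.

Definition simple_refl (p : nat) : 'S_5 := tperm (inord p.-1) (inord p).

(* s_{i_1} s_{i_2} ... as a composite of functions.  The product of 'S_5
   composes from left to right, hence the [rev]; see [on_label_word_perm_cons]. *)
Definition word_perm (i : word) : 'S_5 :=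
  (\prod_(p <- rev i) simple_refl p)%g.

Definition on_label (w : 'S_5) (m : nat) : nat := (w (inord m.-1)).+1.

Lemma on_label_word_perm_cons (p : nat) (i : word) (m : nat) :
  on_label (word_perm (p :: i)) m = on_label (simple_refl p) (on_label (word_perm i) m).
Proof.
by rewrite /on_label /word_perm rev_cons big_rcons permM /= inord_val.
Qed.

Definition w0 : 'S_5 := perm (@rev_ord_inj 5).

Definition reduced_expression (i : word) : Prop :=
  [/\ size i = 10%N, all (fun p => 0 < p < 5)%N i & word_perm i = w0].

Definition far (p q : nat) : bool := (p.+1 < q)%N || (q.+1 < p)%N.
Definition near_by (p q : nat) : bool := (p.+1 == q) || (q.+1 == p).

Definition comm_at (i : word) (k : nat) : bool :=
  (k.+1 < size i)%N && far (nth 0 i k) (nth 0 i k.+1).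
Definition long_at (i : word) (k : nat) : bool :=
  [&& (k.+2 < size i)%N, near_by (nth 0 i k) (nth 0 i k.+1)
    & nth 0 i k.+2 == nth 0 i k].

Definition word_move (i : word) (k : nat) : word :=
  let p := nth 0%N i k in let q := nth 0%N i k.+1 in
  if comm_at i k then take k i ++ [:: q; p] ++ drop k.+2 i
  else if long_at i k then take k i ++ [:: q; p; q] ++ drop k.+3 i
  else i.

Definition comm_move (i i' : word) : Prop :=
  exists2 k, comm_at i k & i' = word_move i k.
Definition long_move (i i' : word) : Prop :=
  exists2 k, long_at i k & i' = word_move i k.

Definition comm_class (i : word) : set word :=
  [set i' | clos_refl_trans word comm_move i i'].

Definition adjacent_classes (C C' : set word) : Prop :=
  exists w w', [/\ C w, C' w' & long_move w w' \/ long_move w' w].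

(* s and s' are consecutive occurrences of a letter in i. *)
Definition consecutive (i : word) (s s' : nat) : Prop :=
  [/\ (s < s' < size i)%N, nth 0%N i s' = nth 0%N i s
    & forall r, (s < r < s')%N -> nth 0%N i r <> nth 0%N i s].

Definition chamber_set (i : word) (s : nat) : set nat :=
  [set on_label (word_perm (take s.+1 i)) m | m in [set m | nth 0 i s < m <= 5]%N].

Definition is_chamber_set (i : word) (S : set nat) : Prop :=
  exists s s', consecutive i s s' /\ S = chamber_set i s.

Inductive arrow : Type := aL | aR | aN.

(* A word of length 3: (edge 4, edge 3, edge 2). *)
Definition quiver : Type := (arrow * arrow * arrow)%type.

Definition edge (P : quiver) (e : nat) : arrow :=
  match e with
  | 4 => P.1.1
  | 3 => P.1.2
  | 2 => P.2
  | _ => aN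
  end%N.

Definition directed (P : quiver) (e : nat) : Prop := edge P e <> aN.

Definition partial_quiver (P : quiver) : Prop :=
  (exists e, directed P e) /\
  (forall e f g, (e <= f <= g)%N ->
     directed P e -> directed P g -> directed P f).

(* Edge numbers decrease from left to right. *)
Definition rightmost (P : quiver) (e : nat) : Prop :=
  directed P e /\ forall f, directed P f -> (e <= f)%N.
Definition leftmost (P : quiver) (e : nat) : Prop :=
  directed P e /\ forall f, directed P f -> (f <= e)%N.

Definition l1 (P : quiver) : set nat := [set e | edge P e = aL].
Definition l2 (P : quiver) : set nat :=
  [set m | exists e, [/\ rightmost P e, edge P e = aR & (1 <= m <= e.-1)%N]].
Definition l3 (P : quiver) : set nat :=
  [set m | exists e, [/\ leftmost P e, edge P e = aR & (e.+1 <= m <= 5)%N]].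
Definition lset (P : quiver) : set nat := l1 P `|` l2 P `|` l3 P.

Definition quivers_of (i : word) : set quiver :=
  [set P | partial_quiver P /\ is_chamber_set i (lset P)].

(* The five triples that are not partial quivers get an unused default. *)
Definition quiver_coords (P : quiver) : seq nat :=
  match P with
  | (aL, aL, aL) => [:: 1; 0; 0; 0; 0; 0; 0; 0; 0; 0]
  | (aL, aL, aR) => [:: 0; 0; 1; 0; 0; 0; 0; 0; 1; 0]
  | (aL, aR, aL) => [:: 1; 1; 0; 0; 0; 0; 1; 1; 0; 0]
  | (aR, aL, aL) => [:: 1; 0; 0; 1; 0; 0; 0; 0; 0; 1]
  | (aL, aR, aR) => [:: 0; 1; 0; 0; 0; 0; 0; 1; 1; 0]
  | (aR, aL, aR) => [:: 0; 0; 1; 1; 0; 0; 0; 0; 1; 1]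
  | (aR, aR, aL) => [:: 1; 0; 0; 0; 0; 0; 1; 0; 0; 0]
  | (aR, aR, aR) => [:: 0; 0; 0; 0; 0; 0; 0; 0; 1; 0]
  | (aL, aL, aN) => [:: 0; 0; 0; 0; 0; 0; 0; 1; 0; 0]
  | (aL, aR, aN) => [:: 0; 1; 0; 0; 0; 1; 0; 0; 0; 0]
  | (aR, aL, aN) => [:: 0; 0; 0; 0; 0; 1; 0; 0; 0; 1]
  | (aR, aR, aN) => [:: 0; 0; 0; 1; 0; 0; 0; 0; 0; 0]
  | (aN, aL, aL) => [:: 1; 0; 0; 0; 0; 0; 0; 0; 0; 1]
  | (aN, aL, aR) => [:: 0; 0; 1; 0; 0; 0; 0; 0; 1; 1]
  | (aN, aR, aL) => [:: 1; 1; 0; 0; 0; 0; 1; 0; 0; 0]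
  | (aN, aR, aR) => [:: 0; 1; 0; 0; 0; 0; 0; 0; 1; 0]
  | (aL, aN, aN) => [:: 0; 1; 0; 0; 0; 0; 0; 1; 0; 0]
  | (aR, aN, aN) => [:: 0; 0; 0; 1; 0; 0; 0; 0; 0; 1]
  | (aN, aL, aN) => [:: 0; 0; 1; 0; 0; 0; 0; 0; 0; 1]
  | (aN, aR, aN) => [:: 0; 1; 0; 0; 0; 0; 1; 0; 0; 0]
  | (aN, aN, aL) => [:: 1; 0; 0; 0; 1; 0; 0; 0; 0; 0]
  | (aN, aN, aR) => [:: 0; 0; 0; 0; 1; 0; 0; 0; 1; 0]
  | _ => [::]
  end%N.

(* v_1, ..., v_4 *)
Definition extra_coords : seq (seq nat) :=
  [:: [:: 1; 0; 0; 0; 1; 0; 0; 0; 1; 0];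
      [:: 0; 0; 1; 0; 0; 0; 1; 0; 0; 0];
      [:: 0; 1; 0; 0; 0; 1; 0; 0; 0; 1];
      [:: 0; 0; 0; 1; 0; 0; 0; 1; 0; 0]]%N.

Definition word_j : word := [:: 1; 3; 2; 4; 1; 3; 2; 4; 1; 3]%N.
Definition word_j' : word := [:: 2; 4; 1; 3; 2; 4; 1; 3; 2; 4]%N.

(* Positions of the successive braid relations in one chosen sequence of
   reduced expressions from j to j'; the composite map does not depend on
   this choice. *)
Definition chain : seq nat :=
  [:: 0; 2; 1; 2; 1; 4; 3; 7; 6; 4; 7; 6; 5; 4; 2; 0; 2; 3; 1; 5; 6; 4; 3; 2;
      4]%N.

Fixpoint is_chain (ks : seq nat) (i i' : word) : bool :=
  if ks is k :: ks' then
    (comm_at i k || long_at i k) && is_chain ks' (word_move i k) i'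
  else i == i'.

Lemma chain_ok : is_chain chain word_j word_j'.
Proof. by []. Qed.

Section Lusztig.
Variable R : realType.

Notation vect := 'rV[R]_10.

Definition coord_move (i : word) (k : nat) (v : seq R) : seq R :=
  let a := nth 0 v k in let b := nth 0 v k.+1 in let c := nth 0 v k.+2 in
  if comm_at i k then take k v ++ [:: b; a] ++ drop k.+2 v
  else if long_at i k then
    take k v ++ (if a <= c then [:: b + c - a; a; b]
                 else [:: b; c; b + a - c]) ++ drop k.+3 v
  else v.

Fixpoint coord_moves (ks : seq nat) (i : word) (v : seq R) : seq R :=
  if ks is k :: ks' then coord_moves ks' (word_move i k) (coord_move i k v)
  else v.

Definition lusztig (v : vect) : vect :=
  \row_k nth 0 (coord_moves chain word_j [seq v 0 l | l <- enum 'I_10]) k.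

Definition linearity_region (X : set vect) : Prop :=
  exists A : {linear vect -> vect},
    let D := [set v | lusztig v = A v] in
    D° !=set0 /\ X = closure D°.

(* The linear form with coefficient vector Q. *)
Definition lform (Q v : vect) : R := \sum_k Q 0 k * v 0 k.

Definition irredundant_system (n : nat) (Q : 'I_n -> vect) (X : set vect) :
    Prop :=
  X = [set v | forall k, 0 <= lform (Q k) v] /\
  forall k, X <> [set v | forall l, l != k -> 0 <= lform (Q l) v].

Definition nonneg_orthant : set vect := [set v | forall k, 0 <= v 0 k].

Definition simplicial_region (Y : set vect) : Prop :=
  exists X, [/\ linearity_region X,
    exists Q : 'I_6 -> vect, irredundant_system Q X
    & Y = X `&` nonneg_orthant].

(* The hyperplane with equation Q = 0, when Q != 0. *)
Definition zero_locus (Q : vect) : set vect := [set v | lform Q v = 0].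

Definition linear_span (A : set vect) : set vect :=
  [set v | exists (n : nat) (c : 'I_n -> R) (x : 'I_n -> vect),
     (forall k, A (x k)) /\ v = \sum_k c k *: x k].

(* A facet is a face X `&` {Q = 0}, with Q >= 0 on X, which spans the whole
   supporting hyperplane {Q = 0}. *)
Definition facet (X F : set vect) : Prop :=
  exists Q, [/\ Q != 0, X `<=` [set v | 0 <= lform Q v],
    F = X `&` zero_locus Q & linear_span F = zero_locus Q].

Definition walls (X : set vect) : set (set vect) :=
  [set H | exists2 F, facet X F & H = linear_span F].

Definition all_walls : set (set vect) :=
  [set H | exists2 X, simplicial_region X & walls X H].

Definition vect_of (s : seq nat) : vect := \row_k (nth 0%N s k)%:R.

Definition vectors_of (i : word) : set vect :=
  [set vect_of (quiver_coords P) | P in quivers_of i] `|`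
  [set vect_of s | s in [set` extra_coords]].

Definition opposite_wall (i : word) (v : vect) (H : set vect) : Prop :=
  unique (fun W => all_walls W /\
                   forall u, vectors_of i u -> u <> v -> W u) H.

Definition is_region_of (i : word) (X : set vect) : Prop :=
  [/\ simplicial_region X,
      walls X = [set H | exists2 v, vectors_of i v & opposite_wall i v H]
    & vectors_of i `<=` X].

Definition region_of (i : word) : set vect := get (is_region_of i).

Definition adjacent_regions (X X' : set vect) : Prop :=
  X <> X' /\
  exists Q : vect,
    [/\ walls X (zero_locus Q), walls X' (zero_locus Q)
      & exists f : set vect -> set vect,
          set_bij (walls X `\ zero_locus Q) (walls X' `\ zero_locus Q) f /\
          forall H, (walls X `\ zero_locus Q) H ->
            exists (Q' : vect) (lambda : R),
              H = zero_locus Q' /\ f H = zero_locus (Q' + lambda *: Q)].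

End Lusztig.

Arguments region_of : clear implicits.

(* Main.v *)
From HB Require Import structures.
From Stdlib Require Import Relations.
Require Import Defs.
From mathcomp Require Import all_boot all_order all_algebra all_fingroup.
From mathcomp Require Import boolp classical_sets functions reals.
From mathcomp Require Import topology normedtype.
From mathcomp Require Import lra zify.

(** For a reduced expression, the region X is the simplicial cone on its ten
    vectors, so both kinds of adjacency can be read off from the vectors.

    Geometry.  Let b be a basis of ten vectors with dual basis q of linear
    forms.  The walls of the cone on b are the ten hyperplanes q k = 0
    ([walls_cone]), and each of them is the only hyperplane through the other
    nine vectors ([opposite_wallP]).  Suppose that two such cones have a common
    wall Q = 0 and that their other walls match up to multiples of Q.  Then
    matching walls cut the common wall in the same subspace, so the two cones
    span the same nine rays there; as all vectors have entries 0 and 1, they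
    share nine vectors.  Conversely, if nine vectors are shared, then the
    hyperplane through these nine is a common wall, and the dual forms of a
    shared vector agree on that hyperplane, hence differ by a multiple of Q
    ([adjacent_regions_share], [share_adjacent_regions]).  So regions are
    adjacent if and only if their sets of vectors differ in exactly one element
    ([adjacent_regionsP]).

    Existence of the regions.  The coordinates of R are integer combinations of
    the ten variables and of six tropical polynomials, that is, minima of linear
    forms, and they determine these six ([lusztigE]); this follows from ten
    three-term relations, one for each long braid relation in the chosen chain.
    Hence, if A is obtained from R by choosing one monomial in each of the six
    polynomials, then R v = A v if and only if every chosen monomial attains its
    minimum at v ([lusztig_linearP]).  This set is a closed convex cone, so its
    interior and the closure of that interior are under control.  For the
    monomials that are minimal on the ten vectors of a reduced expression, the
    cone is cut out by the six dual forms opposite to the vectors of the partial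
    quivers, and the four dual forms opposite to v_1, ..., v_4 are coordinates
    ([frame_okP]).  So the cone on the ten vectors is a simplicial region.

    Combinatorics.  It remains to see that two commutation classes are adjacent
    if and only if their sets of vectors differ in exactly one element
    ([adjacent_classesP]).  A commutation preserves the chamber sets and a long
    braid relation changes exactly one of them; that classes sharing all but one
    chamber set are joined by a long braid relation is a finite check over the
    768 reduced expressions of the longest element, which fall into 62
    commutation classes. *)

Set Implicit Arguments.
Unset Strict Implicit.
Unset Printing Implicit Defensive.

Import Order.TTheory GRing.Theory Num.Theory.
Import numFieldNormedType.Exports.

Local Open Scope classical_set_scope.
Local Open Scope ring_scope.

(** * Simplicial cones and their walls *)

Section Cones.
Variable R : realType.
Notation vect := 'rV[R]_10.
Implicit Types (Q v u : vect) (b q : 'I_10 -> vect).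

Lemma lformC Q v : lform Q v = lform v Q.
Proof. by apply: eq_bigr => k _; rewrite mulrC. Qed.

Lemma lformDr Q u v : lform Q (u + v) = lform Q u + lform Q v.
Proof. by rewrite -big_split; apply: eq_bigr => k _; rewrite mxE mulrDr. Qed.

Lemma lformZr Q a v : lform Q (a *: v) = a * lform Q v.
Proof. by rewrite mulr_sumr; apply: eq_bigr => k _; rewrite mxE mulrCA. Qed.

Lemma lform0r Q : lform Q 0 = 0.
Proof. by rewrite -[0](scale0r 0) lformZr mul0r. Qed.

Lemma lform_sumr (I : finType) (P : pred I) Q (x : I -> vect) :
  lform Q (\sum_(k | P k) x k) = \sum_(k | P k) lform Q (x k).
Proof.
by elim/big_rec2: _ => [|k y v _ <-]; rewrite ?lform0r// lformDr.
Qed.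

Lemma lformDl Q u v : lform (u + v) Q = lform u Q + lform v Q.
Proof. by rewrite lformC lformDr !(lformC Q). Qed.

Lemma lformZl Q a v : lform (a *: v) Q = a * lform v Q.
Proof. by rewrite lformC lformZr lformC. Qed.

Definition dual_to q b := forall j k, lform (q j) (b k) = (j == k)%:R.

Lemma dual_toC q b : dual_to q b -> dual_to b q.
Proof. by move=> qb j k; rewrite lformC qb eq_sym. Qed.

Lemma dual_expand q b v : dual_to q b -> v = \sum_k lform (q k) v *: b k.
Proof.
move=> qb; pose B := \matrix_k b k; pose C := \matrix_k q k.
have CB : C *m B^T = 1%:M.
  apply/matrixP => j k; rewrite !mxE -qb.
  by apply: eq_bigr => l _; rewrite !mxE.
have BC : C^T *m B = 1%:M by rewrite -[B]trmxK -trmx_mul (mulmx1C CB) trmx1.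
rewrite -{1}[v]mulmx1 -BC mulmxA [LHS]mulmx_sum_row.
apply: eq_bigr => k _; rewrite rowK; congr (_ *: _).
by rewrite lformC !mxE; apply: eq_bigr => l _; rewrite !mxE.
Qed.

Definition cone q : set vect := [set v | forall k, 0 <= lform (q k) v].

Lemma cone_generator q b k : dual_to q b -> cone q (b k).
Proof. by move=> qb j; rewrite qb ler0n. Qed.

Lemma dual_neq0 q b k : dual_to q b -> q k != 0.
Proof.
move=> qb; apply/eqP => qk0; have := qb k k.
by rewrite eqxx qk0 lformC lform0r => /esym/eqP; rewrite oner_eq0.
Qed.

Lemma zero_locus_scale a Q : a != 0 -> zero_locus (a *: Q) = zero_locus Q.
Proof.
move=> a0; apply/seteqP; split=> v; rewrite /zero_locus /= lformZl.
  by move/eqP; rewrite mulf_eq0 (negPf a0) => /eqP.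
by move->; rewrite mulr0.
Qed.

(** Expanding Q in the dual basis leaves only a multiple of q k. *)
Lemma zero_locus_dual q b Q k : dual_to q b -> Q != 0 ->
  (forall j, j != k -> lform Q (b j) = 0) -> zero_locus Q = zero_locus (q k).
Proof.
move=> qb Q0 Qb; have QE : Q = lform Q (b k) *: q k.
  rewrite [LHS](dual_expand _ (dual_toC qb)) (bigD1 k)//=.
  rewrite big1 ?addr0 => [|j jk]; first by rewrite lformC.
  by rewrite lformC Qb ?scale0r.
rewrite QE zero_locus_scale//; apply: contra_neq Q0 => Qk.
by rewrite QE Qk scale0r.
Qed.

Lemma span_face q b k : dual_to q b ->
  linear_span (cone q `&` zero_locus (q k)) = zero_locus (q k).
Proof.
move=> qb; apply/seteqP; split=> v /=.
  move=> [n [c [x [xF ->]]]]; rewrite /zero_locus/= lform_sumr big1// => l _.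
  by have [_] := xF l; rewrite /zero_locus/= lformZr => ->; rewrite mulr0.
move=> vk; exists 10%N, (fun l => lform (q l) v).
exists (fun l => if l == k then 0 else b l); split=> [l|].
  case: eqVneq => [_|lk]; split=> [j|] /=; rewrite /zero_locus/= ?lform0r//.
    exact: cone_generator.
  by rewrite qb eq_sym (negPf lk).
rewrite [LHS](dual_expand _ qb); apply: eq_bigr => l _.
by case: eqVneq => // ->; rewrite (vk : lform _ _ = _) !scale0r.
Qed.

(** A form that is nonnegative on the cone is a nonnegative combination of the
    q k; the face where it vanishes spans a hyperplane only if a single
    coefficient is nonzero. *)
Lemma walls_cone q b : dual_to q b ->
  walls (cone q) = [set zero_locus (q k) | k in setT].
Proof.
move=> qb; apply/seteqP; split=> [_ [F [Q [Q0 Qpos FE Fspan]] ->]|_ [k _ <-]].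
  rewrite Fspan; have Qge k : 0 <= lform Q (b k) by exact/Qpos/cone_generator.
  have [k Qk] : exists k, lform Q (b k) != 0.
    apply/not_existsP => Qb; move/eqP: Q0; apply.
    rewrite [LHS](dual_expand _ (dual_toC qb)) big1// => k _.
    rewrite lformC; move/negP: (Qb k); rewrite negbK => /eqP ->.
    by rewrite scale0r.
  exists k => //; apply/esym/(zero_locus_dual qb Q0) => j jk.
  (* If Q were positive on b j as well, the combination of b j and b k below
     would be a zero of Q on which q j does not vanish, while q j vanishes on
     all of the face Q = 0. *)
  apply/eqP; apply: contraT => Qj.
  have : zero_locus Q (lform Q (b k) *: b j - lform Q (b j) *: b k).
    by rewrite /zero_locus/= -scaleN1r lformDr !lformZr; lra.
  rewrite -Fspan => -[n [c [x [xF]]]] /(congr1 (lform (q j))).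
  rewrite -scaleN1r lformDr !lformZr !qb eqxx (negPf jk) !mulr0 addr0 mulr1.
  rewrite lform_sumr big1 => [Qk0|l _]; first by rewrite Qk0 eqxx in Qk.
  rewrite lformZr; have := xF l; rewrite FE => -[xl Qxl].
  suff -> : lform (q j) (x l) = 0 by rewrite mulr0.
  apply/eqP; rewrite eq_le xl andbT.
  have : lform Q (x l) = 0 := Qxl.
  rewrite {1}(dual_expand (x l) qb) lform_sumr (bigD1 j)//= lformZr => Qx.
  have : 0 <= \sum_(k0 | k0 != j) lform Q (lform (q k0) (x l) *: b k0).
    by apply: sumr_ge0 => m _; rewrite lformZr mulr_ge0.
  move: Qx; set S := \sum_(_ | _) _ => /eqP; rewrite addr_eq0 => /eqP Qx S0.
  rewrite -(pmulr_lle0 _ (_ : 0 < lform Q (b j))) ?lt_def ?Qj ?Qge//.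
  by rewrite Qx oppr_le0.
exists (cone q `&` zero_locus (q k)); last by rewrite (span_face _ qb).
exists (q k); split=> //; last exact: span_face qb.
- exact: dual_neq0 qb.
- by move=> v; apply.
Qed.

Lemma all_walls_form (H : set vect) :
  all_walls H -> exists2 Q, Q != 0 & H = zero_locus Q.
Proof. by move=> [X _ [F [Q [Q0 _ _ ->]] ->]]; exists Q. Qed.

(** Nine independent vectors lie on a single hyperplane, and every element of
    [all_walls] is a hyperplane. *)
Lemma opposite_wallP q b i k (H : set vect) : dual_to q b ->
  vectors_of i = range b -> all_walls (zero_locus (q k)) ->
  opposite_wall i (b k) H <-> H = zero_locus (q k).
Proof.
move=> qb iE qk.
have wall_through W : all_walls W ->
    (forall u, vectors_of i u -> u <> b k -> W u) -> W = zero_locus (q k).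
  move=> /all_walls_form[Q Q0 ->] Wb; apply: zero_locus_dual Q0 _ => // j jk.
  apply: Wb; first by rewrite iE; exists j.
  move=> /(congr1 (lform (q j))); rewrite !qb eqxx (negPf jk) => /eqP.
  by rewrite oner_eq0.
split=> [[[]] //|->]; first by move=> Hw Hb _; exact: wall_through.
split; last by move=> W [Ww Wb]; rewrite (wall_through W).
split=> // u; rewrite iE => -[j _ <-] bjk; rewrite /zero_locus/= qb.
by case: eqVneq bjk => // ->.
Qed.

Lemma cone_is_region q b i : dual_to q b -> vectors_of i = range b ->
  simplicial_region (cone q) -> is_region_of i (cone q).
Proof.
move=> qb iE sq; have wq k : all_walls (zero_locus (q k)).
  by exists (cone q) => //; rewrite (walls_cone qb); exists k.
split=> //; last by rewrite iE => _ [k _ <-]; exact: cone_generator.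
rewrite (walls_cone qb); apply/seteqP; split=> H.
  move=> [k _ <-]; exists (b k); first by rewrite iE; exists k.
  exact/(opposite_wallP _ qb iE).
move=> [v]; rewrite iE => -[k _ <-] /(opposite_wallP _ qb iE)->//.
Qed.

(** Adjacency depends on the chosen region only through its walls, and these
    are prescribed by the vectors as soon as some region has them. *)
Lemma walls_region_of q b i : dual_to q b -> vectors_of i = range b ->
  simplicial_region (cone q) ->
  walls (region_of R i) = [set zero_locus (q k) | k in setT].
Proof.
move=> qb iE sq; have cq := cone_is_region qb iE sq.
have /getPex[_ -> _] : exists X, is_region_of (R := R) i X by exists (cone q).
by rewrite -(walls_cone qb); case: cq.
Qed.

Definition zero_one v := forall x, v 0 x = 0 \/ v 0 x = 1.

(** Walls determine generators up to scaling; this pins down the scaling. *)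
Lemma zero_one_ray c u v :
  zero_one u -> zero_one v -> v != 0 -> v = c *: u -> v = u.
Proof.
move=> u01 v01 v0 vE; suff c1 : c = 1 by rewrite vE c1 scale1r.
have [x vx] : exists x, v 0 x != 0.
  apply/not_existsP => v00; move/eqP: v0; apply; apply/rowP => x.
  by rewrite mxE; move/negP: (v00 x); rewrite negbK => /eqP.
have : v 0 x = c * u 0 x by rewrite {1}vE mxE.
case: (v01 x) vx => -> //; rewrite ?eqxx// => _.
by case: (u01 x) => ->; rewrite ?mulr0 ?mulr1// => /eqP; rewrite oner_eq0.
Qed.

Lemma zero_one_dual q b l v : dual_to q b -> zero_one (b l) -> zero_one v ->
  v != 0 -> (forall j, j != l -> lform (q j) v = 0) -> v = b l.
Proof.
move=> qb b01 v01 v0 qv; apply: (zero_one_ray (c := lform (q l) v)) => //.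
rewrite [LHS](dual_expand _ qb) (bigD1 l)//= big1 ?addr0// => j jl.
by rewrite qv ?scale0r.
Qed.

Lemma zero_locus_inj q b j k : dual_to q b ->
  zero_locus (q j) = zero_locus (q k) -> j = k.
Proof.
move=> qb jk; apply/eqP; apply: contraT => njk.
have : zero_locus (q j) (b k) by rewrite /zero_locus/= qb (negPf njk).
by rewrite jk /zero_locus/= qb eqxx => /eqP; rewrite oner_eq0.
Qed.

Section TwoCones.
Variables q b q' b' : 'I_10 -> vect.
Hypotheses (qb : dual_to q b) (qb' : dual_to q' b').
Hypotheses (b01 : forall k, zero_one (b k)) (b01' : forall k, zero_one (b' k)).
Variables X X' : set vect.
Hypothesis wX : walls X = [set zero_locus (q k) | k in setT].
Hypothesis wX' : walls X' = [set zero_locus (q' k) | k in setT].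

(** A generator lies on all walls but one, and this determines its ray. *)
Lemma walls_eq_generators k : walls X = walls X' -> exists k', b k = b' k'.
Proof.
move=> XX'; have /choice[g gE] j :
    exists j', zero_locus (q j) = zero_locus (q' j').
  have : walls X' (zero_locus (q j)) by rewrite -XX' wX; exists j.
  by rewrite wX' => -[j' _ <-]; exists j'.
have g_inj : injective g.
  by move=> j l gjl; apply: (zero_locus_inj qb); rewrite !gE gjl.
exists (g k); apply: (zero_one_dual qb') => //.
  exact: dual_neq0 (dual_toC qb).
move=> j'; rewrite -(f_invF g_inj j') (inj_eq g_inj) => jk.
suff : zero_locus (q' (g (invF g_inj j'))) (b k) by [].
by rewrite -gE /zero_locus/= qb (negPf jk).
Qed.

(** On the common wall Q = 0 a wall and its image cut out the same subspace,
    since their equations differ there by a multiple of Q.  So the generator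
    opposite to the image of the l-th wall lies on all walls of the first cone
    except the l-th one, and it is on the ray of b l. *)
Lemma adjacent_regions_share : adjacent_regions X X' ->
  exists k, forall l, l != k -> exists l', b l = b' l'.
Proof.
move=> [_ [Q [+ + [f [[f_fun f_inj _] fE]]]]].
rewrite wX wX' => -[k _ kQ] [k' _ k'Q]; exists k => l lk.
have wall j : j != k -> (walls X `\ zero_locus Q) (zero_locus (q j)).
  move=> jk; rewrite wX; split; first by exists j.
  by rewrite -kQ => /(zero_locus_inj qb)/eqP; rewrite (negPf jk).
have image j : j != k ->
    exists2 j', j' != k' & f (zero_locus (q j)) = zero_locus (q' j').
  move=> /wall/f_fun; rewrite wX' => -[[j' _ <-] j'Q]; exists j' => //.
  by apply: contra_notN j'Q => /eqP ->.
have [l' lk' fl] := image l lk; exists l'; apply/esym.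
apply: (zero_one_dual qb) => //; first exact: dual_neq0 (dual_toC qb').
have Ql' : lform Q (b' l') = 0.
  suff : zero_locus Q (b' l') by [].
  by rewrite -k'Q /zero_locus/= qb' eq_sym (negPf lk').
move=> j jl; have [->|jk] := eqVneq j k.
  by suff : zero_locus (q k) (b' l') by []; rewrite kQ.
have [j' jk' fj] := image j jk; have [Qj [c [jE fjE]]] := fE _ (wall j jk).
have jl' : j' != l'.
  apply: contra_neq jl => j'l'; apply: (zero_locus_inj qb).
  by apply: f_inj; rewrite ?inE ?fj ?fl ?j'l'//; exact: wall.
have : zero_locus (q' j') (b' l') by rewrite /zero_locus/= qb' (negPf jl').
rewrite -fj fjE /zero_locus/= lformDl lformZl Ql' mulr0 addr0 => Qjl.
by suff : zero_locus (q j) (b' l') by []; rewrite jE.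
Qed.

(** The dual forms opposite to a shared generator take the same values on the
    nine shared generators, which span the wall q k = 0; therefore they differ
    by a multiple of q k. *)
Lemma share_adjacent_regions k k' :
  (forall j, j != k -> exists2 j', j' != k' & b j = b' j') ->
  (forall j', j' != k' -> exists2 j, j != k & b j = b' j') ->
  (forall j', b k <> b' j') ->
  adjacent_regions X X'.
Proof.
move=> bb' b'b bk; split=> [XX'|].
  by have [|j' /bk] := @walls_eq_generators k; rewrite ?XX'.
have /choice[s sP] j : exists j', j != k -> j' != k' /\ b j = b' j'.
  have [->|/bb'[j' ? ?]] := eqVneq j k; first by exists k.
  by exists j'.
have qE j l : l != k -> lform (q' j) (b l) = (j == s l)%:R.
  by move=> /sP[_ ->]; rewrite qb'.
have sk j : j != k -> s j != k' by move=> /sP[].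
have kE : zero_locus (q' k') = zero_locus (q k).
  apply: (zero_locus_dual qb); first exact: dual_neq0 qb'.
  by move=> j jk; rewrite qE// eq_sym (negPf (sk _ jk)).
have s_inj j l : j != k -> l != k -> s j = s l -> j = l.
  move=> /sP[_ bj] /sP[_ bl] jl; have : b j = b l by rewrite bj bl jl.
  move=> /(congr1 (lform (q j))); rewrite !qb eqxx.
  by case: eqVneq => // _ /eqP; rewrite oner_eq0.
pose f (H : set vect) :=
  zero_locus (q' (s (xget k [set j | zero_locus (q j) = H]))).
have fE j : f (zero_locus (q j)) = zero_locus (q' (s j)).
  rewrite /f; case: xgetP => [l _ /= /(zero_locus_inj qb) -> //|/(_ j)].
  by case.
have wallsP (Y : set vect) p c m : dual_to p c ->
    walls Y = [set zero_locus (p k) | k in setT] -> forall H,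
    (walls Y `\ zero_locus (p m)) H <->
    exists2 j, j != m & H = zero_locus (p j).
  move=> pc -> H; split=> [[[j _ <-] jm]|[j jm ->]].
    by exists j => //; apply: contra_notN jm => /eqP ->.
  split; first by exists j.
  by move=> /= /(zero_locus_inj pc)/eqP; rewrite (negPf jm).
exists (q k); split; [by rewrite wX; exists k|by rewrite wX' -kE; exists k'|].
exists f; rewrite -{2}kE; split; first split.
- move=> H /(wallsP _ _ _ _ qb wX)[j jk ->]; rewrite fE.
  by apply/(wallsP _ _ _ _ qb' wX'); exists (s j) => //; exact: sk.
- move=> H H'; rewrite !inE => /(wallsP _ _ _ _ qb wX)[j jk ->].
  move=> /(wallsP _ _ _ _ qb wX)[l lk ->]; rewrite !fE.
  by move=> /(zero_locus_inj qb')/s_inj ->.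
- move=> H /(wallsP _ _ _ _ qb' wX')[j' jk' ->]; have [j jk jj'] := b'b _ jk'.
  exists (zero_locus (q j)); first by apply/(wallsP _ _ _ _ qb wX); exists j.
  rewrite fE; suff -> : s j = j' by [].
  apply/eqP; have := qE (s j) j jk; rewrite eqxx jj' qb'.
  by case: eqVneq => // _ /esym/eqP; rewrite oner_eq0.
move=> H /(wallsP _ _ _ _ qb wX)[j jk ->].
exists (q j), (lform (q' (s j)) (b k)); split=> //; rewrite fE.
congr zero_locus.
rewrite [LHS](dual_expand _ (dual_toC qb)) (bigD1 k)//= (bigD1 j)//= big1.
  by rewrite addr0 !(lformC (b _)) (qE _ _ jk) eqxx scale1r addrC.
move=> l /andP[lk lj]; rewrite lformC (qE _ _ lk).
case: eqVneq => [/(s_inj _ _ jk lk) jl|_]; last by rewrite scale0r.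
by rewrite jl eqxx in lj.
Qed.

End TwoCones.
End Cones.

(** * Regions of linearity as cones *)

Section Regions.
Variable R : realType.
Notation vect := 'rV[R]_10.
Implicit Types (E : pred 'I_10) (Q v u : vect) (b q : 'I_10 -> vect).

Lemma lform_continuous Q : continuous (lform Q).
Proof.
apply: (@continuous_big R _ +%R 0); first exact: add_continuous.
move=> k _ v; have := @coord_continuous R 1 10 0 k v.
by move=> /(cvgM (cvg_cst (Q 0 k))).
Qed.

Definition partial_cone (E : pred 'I_10) q : set vect :=
  [set v | forall k, E k -> 0 <= lform (q k) v].

Lemma partial_cone_closed E q : closed (partial_cone E q).
Proof.
rewrite (_ : partial_cone E q =
    \bigcap_(k in [set k | E k]) (lform (q k) @^-1` [set y | 0 <= y])).
  apply: closed_bigI => k _; apply: preimage_closed; last exact: closed_ge.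
  by move=> v _; exact: lform_continuous.
by apply/seteqP; split=> v vE k /vE.
Qed.

Lemma partial_cone_interior E q v :
  (forall k, E k -> 0 < lform (q k) v) -> (partial_cone E q)° v.
Proof.
move=> vE; have near_k k : \forall w \near v, E k -> 0 < lform (q k) w.
  have [Ek|_] := boolP (E k); last by apply: (@nearW _ (nbhs v)).
  have : \forall y \near lform (q k) v, 0 < y.
    by apply: open_nbhs_nbhs; split; [exact: open_gt|exact: vE].
  by move=> /(@lform_continuous (q k)); apply: (@filterS _ (nbhs v)) => w.
have := filter_forall (nbhs_filter v) near_k; apply: (@filterS _ (nbhs v)).
by move=> w wE k /wE /ltW.
Qed.

(** Being cut out by independent forms, such a cone is the closure of its
    interior; the sum of the basis vectors is an interior point. *)
Lemma partial_cone_regular E q b : dual_to q b ->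
  (partial_cone E q)° !=set0 /\ closure (partial_cone E q)° = partial_cone E q.
Proof.
move=> qb; pose u := \sum_k b k.
have qu k : lform (q k) u = 1.
  rewrite lform_sumr (bigD1 k)//= qb eqxx big1 ?addr0// => j jk.
  by rewrite qb eq_sym (negPf jk).
split.
  by exists u; apply: partial_cone_interior => k _; rewrite qu.
apply/seteqP; split.
  rewrite [X in _ `<=` X](closure_id _).1; last exact: partial_cone_closed.
  by apply: closureS; exact: interior_subset.
(* Points of the cone are limits of interior points v + t *: u, t > 0. *)
move=> v vE B vB.
have : \forall t \near (0 : R)^'+, B (v + t *: u).
  have : v + t *: u @[t --> (0 : R)^'+] --> v.
    rewrite -[X in _ --> X]addr0 -[X in _ + X](scale0r u).
    apply: cvgD; first exact: cvg_cst.
    by apply: cvgZr_tmp; exact: cvg_within.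
  exact.
move=> /(filterI (nbhs_right_gt 0))/filter_ex[t [t0 Bt]].
exists (v + t *: u); split=> //; apply: partial_cone_interior => k Ek.
by rewrite lformDr lformZr qu mulr1 ltr_wpDl// vE.
Qed.

Definition form_map (a : 'I_10 -> vect) v : vect := \row_k lform (a k) v.

Lemma form_map_linear a : linear (form_map a).
Proof. by move=> c u v; apply/rowP => k; rewrite !mxE lformDr lformZr. Qed.

HB.instance Definition _ a :=
  GRing.isLinear.Build R vect vect _ (form_map a) (form_map_linear a).

Definition coord_form (c : 'I_10) : vect := delta_mx 0 c.

Lemma coord_formE c v : lform (coord_form c) v = v 0 c.
Proof.
rewrite /lform (bigD1 c)//= big1 ?addr0 => [|k kc].
  by rewrite mxE !eqxx mul1r.
by rewrite mxE (negPf kc) andbF mul0r.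
Qed.

(** If R agrees with a linear map exactly on the cone cut out by the first six
    dual forms, that cone is a region of linearity, with six inequalities that
    are irredundant by independence.  The orthant adds the other four, which are
    coordinates; the remaining six coordinates are nonnegative on the cone
    because the generators are. *)
Lemma cone_simplicial q b (a : 'I_10 -> vect) :
  dual_to q b -> (forall k, nonneg_orthant (b k)) ->
  [set v | lusztig v = form_map a v] = partial_cone (fun k => k < 6)%N q ->
  (forall k : 'I_10, (6 <= k)%N -> exists c, q k = coord_form c) ->
  simplicial_region (cone q).
Proof.
move=> qb b_ge0 aE q_coord.
have [E0 E1] := partial_cone_regular (fun k : 'I_10 => k < 6)%N qb.
exists (partial_cone (fun k : 'I_10 => k < 6)%N q); split.
- by exists (form_map a : {linear vect -> vect}); rewrite /= aE.
- exists (fun k => q (widen_ord (isT : 6 <= 10)%N k)); split=> [|k].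
    apply/seteqP; split=> v vE k; first by apply: vE => /=.
    move=> k6; have := vE (Ordinal k6).
    by congr (0 <= lform (q _) v); exact: val_inj.
  set w := widen_ord _; move/seteqP => [_ /(_ (- b (w k))) sub].
  (* - b (w k) violates the k-th inequality and no other one. *)
  have /sub/(_ (w k) (ltn_ord k)) :
      forall l, l != k -> 0 <= lform (q (w l)) (- b (w k)).
    move=> l lk; rewrite -scaleN1r lformZr qb.
    by rewrite (_ : (w l == w k) = false) ?mulr0//; exact: negbTE lk.
  by rewrite -scaleN1r lformZr qb eqxx mulr1 oppr_ge0 ler10.
- apply/seteqP; split=> v; last first.
    move=> [vE v_ge0] k; case: (ltnP k 6) => [/vE //|/q_coord[c ->]].
    by rewrite coord_formE; exact: v_ge0.
  move=> vq; split=> [k _|x]; first exact: vq.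
  rewrite (dual_expand v qb) summxE; apply: sumr_ge0 => k _.
  by rewrite mxE mulr_ge0//; exact: b_ge0.
Qed.
End Regions.

(** * Tropical polynomials and a formula for Lusztig's function *)

Section SameElements.
Variable T : eqType.
Implicit Types s t : seq T.

Definition same_elems s t := all [in t] s && all [in s] t.

Lemma same_elemsP s t : reflect (s =i t) (same_elems s t).
Proof.
apply: (iffP andP) => [[/allP st /allP ts] x|st].
  by apply/idP/idP; [exact: st|exact: ts].
by split; apply/allP => x; rewrite /= st.
Qed.

(** Cancelling in n - d, where n and d are multisets; this keeps the fractions
    below small. *)
Fixpoint cancel_common n d : seq T * seq T :=
  if n is x :: n' then
    if x \in d then cancel_common n' (rem x d)
    else let c := cancel_common n' d in (x :: c.1, c.2)
  else ([::], d).

Lemma cancel_common_sum (V : zmodType) (f : T -> V) n d :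
  \sum_(x <- (cancel_common n d).1) f x -
  \sum_(x <- (cancel_common n d).2) f x =
  \sum_(x <- n) f x - \sum_(x <- d) f x.
Proof.
elim: n d => [//|x n IH] d /=; case: ifP => [xd|_]; last first.
  by rewrite /= !big_cons -!addrA IH.
rewrite IH (perm_big _ (perm_to_rem xd)) !big_cons.
by rewrite opprD addrACA subrr add0r.
Qed.

End SameElements.

(** A tropical monomial is a linear form with natural coefficients, encoded as
    the sorted list of its variables with repetition. *)
Definition tmono := seq nat.
Definition tpoly := seq tmono.

Definition tmul (p p' : tpoly) : tpoly :=
  [seq sort leq (m ++ m') | m <- p, m' <- p'].

(** The ten coordinates, followed by the polynomials that arise along the chain,
    one for each long braid relation. *)
Definition terms : seq tpoly :=
  [seq [:: [:: x]] | x <- iota 0 10] ++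
  [:: [:: [:: 0]; [:: 4]];
      [:: [:: 0; 2]; [:: 0; 6]; [:: 4; 6]];
      [:: [:: 0]; [:: 4]; [:: 8]];
      [:: [:: 0; 2; 5]; [:: 0; 2; 9]; [:: 0; 6; 9]; [:: 4; 6; 9]];
      [:: [:: 0; 2; 3; 5]; [:: 0; 2; 3; 9]; [:: 0; 2; 7; 9]; [:: 0; 3; 6; 9];
          [:: 0; 6; 7; 9]; [:: 3; 4; 6; 9]; [:: 4; 6; 7; 9]];
      [:: [:: 0; 1; 2; 3; 5]; [:: 0; 1; 2; 3; 9]; [:: 0; 1; 2; 7; 9];
          [:: 0; 1; 3; 6; 9]; [:: 0; 1; 6; 7; 9]; [:: 0; 5; 6; 7; 9];
          [:: 1; 3; 4; 6; 9]; [:: 1; 4; 6; 7; 9]; [:: 4; 5; 6; 7; 9]];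
      [:: [:: 0; 1; 2; 2; 3; 4; 5]; [:: 0; 1; 2; 2; 3; 4; 9];
          [:: 0; 1; 2; 2; 3; 5; 8]; [:: 0; 1; 2; 2; 3; 8; 9];
          [:: 0; 1; 2; 2; 4; 7; 9]; [:: 0; 1; 2; 2; 7; 8; 9];
          [:: 0; 1; 2; 3; 4; 6; 9]; [:: 0; 1; 2; 3; 5; 6; 8];
          [:: 0; 1; 2; 3; 6; 8; 9]; [:: 0; 1; 2; 4; 6; 7; 9];
          [:: 0; 1; 2; 6; 7; 8; 9]; [:: 0; 1; 3; 6; 6; 8; 9];
          [:: 0; 1; 6; 6; 7; 8; 9]; [:: 0; 2; 5; 6; 7; 8; 9];
          [:: 0; 5; 6; 6; 7; 8; 9]; [:: 1; 2; 3; 4; 4; 6; 9];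
          [:: 1; 2; 3; 4; 6; 8; 9]; [:: 1; 2; 4; 4; 6; 7; 9];
          [:: 1; 2; 4; 6; 7; 8; 9]; [:: 1; 3; 4; 6; 6; 8; 9];
          [:: 1; 4; 6; 6; 7; 8; 9]; [:: 4; 5; 6; 6; 7; 8; 9]];
      [:: [:: 1; 2; 4]; [:: 1; 2; 8]; [:: 1; 6; 8]; [:: 5; 6; 8]];
      [:: [:: 1; 2; 3; 4; 5]; [:: 1; 2; 3; 4; 9]; [:: 1; 2; 3; 5; 8];
          [:: 1; 2; 3; 8; 9]; [:: 1; 2; 4; 7; 9]; [:: 1; 2; 7; 8; 9];
          [:: 1; 3; 6; 8; 9]; [:: 1; 6; 7; 8; 9]; [:: 5; 6; 7; 8; 9]];
      [:: [:: 1; 2; 3; 5]; [:: 1; 2; 3; 9]; [:: 1; 2; 7; 9]; [:: 1; 3; 6; 9];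
          [:: 1; 6; 7; 9]; [:: 5; 6; 7; 9]]]%N.

(** (x, y, z) stands for x + y = z, tropically min (x, y) = z, where x, y and z
    are products of [terms] given by their indices.  Each relation introduces
    one new term. *)
Definition three_term_relations : seq (seq nat * seq nat * seq nat) :=
  [:: ([:: 0], [:: 4], [:: 10]);
      ([:: 0; 2], [:: 6; 10], [:: 11]);
      ([:: 10], [:: 8], [:: 12]);
      ([:: 0; 2; 5], [:: 9; 11], [:: 13]);
      ([:: 3; 13], [:: 7; 9; 11], [:: 14]);
      ([:: 1; 14], [:: 5; 6; 7; 9; 10], [:: 15]);
      ([:: 1; 2; 4; 12; 14], [:: 8; 11; 15], [:: 10; 16]);
      ([:: 16], [:: 3; 5; 6; 8; 13], [:: 14; 17]);
      ([:: 1; 2; 3; 4; 5; 6; 12], [:: 16], [:: 11; 18]);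
      ([:: 18], [:: 15], [:: 12; 19])]%N.

Section Tropical.
Variable R : realType.
Notation vect := 'rV[R]_10.
Implicit Types (v : vect) (m : tmono) (p : tpoly).

Definition mono_val m v : R := \sum_(x <- m) v 0 (inord x).

Definition trop p v : R :=
  foldr (fun m y => Num.min (mono_val m v) y) (mono_val (head [::] p) v)
        (behead p).

Lemma trop_le p m v : m \in p -> trop p v <= mono_val m v.
Proof.
case: p => // m0 p; rewrite /trop in_cons /=.
elim: p => [|m' p IH] /=; first by rewrite orbF => /eqP ->.
rewrite ge_min in_cons => /or3P[m_m0|/eqP ->|mp]; rewrite ?lexx//.
  by rewrite IH ?m_m0 ?orbT.
by rewrite IH ?mp !orbT.
Qed.

Lemma trop_in p v : p != [::] -> exists2 m, m \in p & trop p v = mono_val m v.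
Proof.
case: p => // m0 p _; rewrite /trop /=.
elim: p => [|m' p [m mp mE]] /=; first by exists m0; rewrite ?mem_head.
rewrite mE; case: leP => _; first by exists m'; rewrite // !in_cons eqxx orbT.
by exists m => //; move: mp; rewrite !in_cons => /orP[] ->; rewrite ?orbT.
Qed.

Lemma trop_unique p v y : (exists2 m, m \in p & y = mono_val m v) ->
  (forall m, m \in p -> y <= mono_val m v) -> trop p v = y.
Proof.
move=> [m mp yE] y_le; apply/eqP; rewrite eq_le {1}yE trop_le//=.
have [|m' m'p ->] := @trop_in p v; last exact: y_le.
by case: (p) mp.
Qed.

Lemma eq_trop p p' v : p != [::] -> p =i p' -> trop p v = trop p' v.
Proof.
move=> p0 pp'; have [m mp mE] := trop_in v p0.
apply/esym/trop_unique; first by exists m; rewrite -?pp'.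
by move=> m'; rewrite -pp'; exact: trop_le.
Qed.

Lemma trop_cat p p' v : p != [::] -> p' != [::] ->
  trop (p ++ p') v = Num.min (trop p v) (trop p' v).
Proof.
move=> /(trop_in v)[m mp mE] /(trop_in v)[m' m'p mE']; apply: trop_unique.
  by rewrite mE mE'; case: leP => _; [exists m|exists m'] => //;
     rewrite mem_cat ?mp ?m'p ?orbT.
by move=> m1; rewrite mem_cat ge_min => /orP[] /trop_le ->; rewrite ?orbT.
Qed.

Lemma mono_val_sort m v : mono_val (sort leq m) v = mono_val m v.
Proof. by rewrite /mono_val; apply: perm_big; rewrite perm_sort. Qed.

Lemma trop_mul p p' v : p != [::] -> p' != [::] ->
  tmul p p' != [::] /\ trop (tmul p p') v = trop p v + trop p' v.
Proof.
move=> /(trop_in v)[m mp mE] /(trop_in v)[m' m'p mE'].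
have mm' : sort leq (m ++ m') \in tmul p p' by apply/allpairsP; exists (m, m').
split; first by case: (tmul p p') mm'.
apply: trop_unique.
  exists (sort leq (m ++ m')) => //.
  by rewrite mono_val_sort /mono_val big_cat mE mE'.
move=> _ /allpairsP[[m1 m2] [/= m1p m2p ->]].
by rewrite mono_val_sort /mono_val big_cat lerD ?trop_le.
Qed.

Definition term (j : nat) : tpoly := nth [::] terms j.

Definition texpand (x : seq nat) : tpoly :=
  foldr (fun j => tmul (term j)) [:: [::]] x.

Definition term_val (v : vect) (j : nat) : R := trop (term j) v.

(** The bound 20 is the number of [terms]. *)
Lemma texpand_val x v : all (fun j => j < 20)%N x ->
  texpand x != [::] /\ trop (texpand x) v = \sum_(j <- x) term_val v j.
Proof.
elim: x => [_|j x IH] /=.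
  by rewrite big_nil /trop /= /mono_val big_nil.
move=> /andP[j20 /IH[x0 xE]]; have j0 : term j != [::].
  by move: j j20; do 20?case=> //.
by have [? ->] := trop_mul v j0 x0; rewrite big_cons xE.
Qed.

(** Addition of tropical polynomials is idempotent, so a relation holds as soon
    as both sides have the same set of monomials. *)
Definition relation_ok (r : seq nat * seq nat * seq nat) : bool :=
  let: (x, y, z) := r in
  all (fun j => j < 20)%N (x ++ y ++ z) &&
  same_elems (texpand x ++ texpand y) (texpand z).

Lemma relations_ok : all relation_ok three_term_relations.
Proof. by vm_compute. Qed.

Lemma relation_val x y z v : relation_ok (x, y, z) ->
  Num.min (\sum_(j <- x) term_val v j) (\sum_(j <- y) term_val v j) =
  \sum_(j <- z) term_val v j.
Proof.
rewrite /relation_ok !all_cat => /andP[/and3P[xs ys zs] /same_elemsP xyz].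
have [x0 <-] := texpand_val v xs; have [y0 <-] := texpand_val v ys.
have [_ <-] := texpand_val v zs.
by rewrite -trop_cat//; apply: eq_trop xyz; case: (texpand x) x0.
Qed.

(** A tropical quotient of two products of [terms]. *)
Definition frac : Type := (seq nat * seq nat)%type.

Definition frac_val (v : vect) (c : frac) : R :=
  \sum_(j <- c.1) term_val v j - \sum_(j <- c.2) term_val v j.

Lemma cancel_common_val v n d :
  frac_val v (cancel_common n d) =
  \sum_(j <- n) term_val v j - \sum_(j <- d) term_val v j.
Proof. exact: cancel_common_sum. Qed.

(** The long braid relation on fractions.  If a - c = x - y and
    min (x, y) = z, then min (a, c) = a + z - x, which is m here, and the new
    coordinates are b + c - m, m and a + b - m. *)
Definition sym_move (k : nat) (r : seq nat * seq nat * seq nat)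
    (E : seq frac) : option (seq frac) :=
  let: (x, y, z) := r in
  let c0 := ([::], [::]) in
  let a := nth c0 E k in let b := nth c0 E k.+1 in let c := nth c0 E k.+2 in
  let m := cancel_common (a.1 ++ z) (a.2 ++ x) in
  if perm_eq (a.1 ++ c.2 ++ y) (c.1 ++ a.2 ++ x) then
    Some (take k E
      ++ [:: cancel_common (b.1 ++ c.1 ++ m.2) (b.2 ++ c.2 ++ m.1); m;
             cancel_common (a.1 ++ b.1 ++ m.2) (a.2 ++ b.2 ++ m.1)]
      ++ drop k.+3 E)
  else None.

Fixpoint sym_moves (ks : seq nat) (i : word) rs (E : seq frac) :=
  if ks is k :: ks' then
    let i' := word_move i k in
    if comm_at i k then
      let c0 := ([::], [::]) in
      sym_moves ks' i' rs
        (take k E ++ [:: nth c0 E k.+1; nth c0 E k] ++ drop k.+2 E)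
    else if long_at i k then
      if rs is r :: rs' then obind (sym_moves ks' i' rs') (sym_move k r E)
      else None
    else None
  else Some E.

Lemma nth_frac_val v E k :
  nth 0 (map (frac_val v) E) k = frac_val v (nth ([::], [::]) E k).
Proof.
have [kE|Ek] := ltnP k (size E); first by rewrite (nth_map ([::], [::])).
by rewrite !nth_default ?size_map// /frac_val !big_nil subrr.
Qed.

Lemma sym_move_val v i k r E E' :
  relation_ok r -> ~~ comm_at i k -> long_at i k ->
  sym_move k r E = Some E' ->
  coord_move i k (map (frac_val v) E) = map (frac_val v) E'.
Proof.
case: r => [[x y] z] /relation_val-/(_ v) rE /negPf nc lk.
rewrite /sym_move /coord_move nc lk !nth_frac_val.
move: (nth _ E k) (nth _ E k.+1) (nth _ E k.+2) => a b c.
case: ifP => // abc [<-].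
rewrite map_cat /= map_take map_drop; congr (_ ++ _).
rewrite !cancel_common_val !big_cat /=.
set m := cancel_common _ _.
have := cancel_common_val v (a.1 ++ z) (a.2 ++ x); rewrite -/m !big_cat -rE /=.
have : \sum_(j <- a.1 ++ c.2 ++ y) term_val v j =
       \sum_(j <- c.1 ++ a.2 ++ x) term_val v j by exact: perm_big.
rewrite !big_cat /frac_val /=.
move: (\sum_(j <- x) _) (\sum_(j <- y) _) => X Y XY.
case: (leP X Y) => XYle mE; case: leP => acle; congr [:: _, _, _ & _]; lra.
Qed.

Lemma sym_moves_val v ks i rs E E' : all relation_ok rs ->
  sym_moves ks i rs E = Some E' ->
  coord_moves ks i (map (frac_val v) E) = map (frac_val v) E'.
Proof.
elim: ks i rs E => [|k ks IH] i rs E /= rs_ok; first by move=> [<-].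
case: ifP => [ck|nck] //.
  move=> /IH-/(_ rs_ok) <-; congr coord_moves.
  by rewrite /coord_move ck !nth_frac_val map_cat /= map_take map_drop.
case: ifP => // lk; case: rs rs_ok => // r rs /andP[r_ok rs_ok].
case EE: (sym_move k r E) => [E1|] //= /IH-/(_ rs_ok) <-.
by rewrite (sym_move_val _ _ _ _ EE) ?nck.
Qed.

(** The ten coordinates of R as fractions in [terms]. *)
Definition lusztig_fracs : seq frac :=
  [:: ([:: 2; 4; 5; 6; 7; 9], [:: 15]); ([:: 3; 5; 6; 8], [:: 17]);
      ([:: 15], [:: 19]); ([:: 15; 17], [:: 16]); ([:: 16; 19], [:: 15; 18]);
      ([:: 16], [:: 13; 17]); ([:: 18], [:: 19]); ([:: 13; 18], [:: 16]);
      ([:: 1; 2; 4; 3; 5; 6], [:: 18]); ([:: 0; 2; 5; 7], [:: 13])]%N.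

Lemma term_val_coord v (k : 'I_10) : term_val v k = v 0 k.
Proof.
rewrite /term_val (_ : term k = [:: [:: val k]]).
  by rewrite /trop /= /mono_val big_seq1 inord_val.
rewrite /term nth_cat size_map size_iota ltn_ord.
by rewrite (nth_map 0%N) ?size_iota// nth_iota.
Qed.

Lemma lusztigE v k :
  lusztig v 0 k = frac_val v (nth ([::], [::]) lusztig_fracs k).
Proof.
rewrite mxE -nth_frac_val; congr (nth 0 _ k).
rewrite -(@sym_moves_val v chain word_j three_term_relations
            [seq ([:: x], [::]) | x <- iota 0 10] _ relations_ok); last first.
  by vm_compute.
congr coord_moves; rewrite -val_enum_ord -!map_comp; apply: eq_map => l /=.
by rewrite /frac_val /= big_seq1 big_nil subr0 term_val_coord.
Qed.

End Tropical.

(** * Simplicial regions from ten vectors *)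

(** The indices of the nonlinear terms that occur in [lusztig_fracs]. *)
Definition final_terms : seq nat := [:: 13; 15; 16; 17; 18; 19]%N.

Definition pairing (b : seq nat) (m : tmono) : nat :=
  sumn [seq nth 0%N b x | x <- m].

(** The monomial of p that is minimal at every vector of vs at once, when there
    is one; that it is one is part of [frame_ok]. *)
Definition lead (vs : seq (seq nat)) (p : tpoly) : tmono :=
  let rows := [seq [seq pairing b m | b <- vs] | m <- p] in
  let least := foldr (fun r a => [seq minn x.1 x.2 | x <- zip r a])
                     (head [::] rows) rows in
  nth [::] p (index least rows).

(** The pairs whose difference of monomials is an inequality that defines the
    region where R is linear with the given leading monomials. *)
Definition gaps vs : seq (tmono * tmono) :=
  flatten [seq let l := lead vs (term j) in [seq (l, m) | m <- term j]
          | j <- final_terms].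

Definition gap vs (g : tmono * tmono) : seq nat :=
  [seq (pairing b g.2 - pairing b g.1)%N | b <- vs].

Definition delta (k : nat) : seq nat :=
  [seq nat_of_bool (k == j) | j <- iota 0 10].

(** A finite certificate that ten vectors span a simplicial region: all gaps are
    nonnegative on the first six vectors and zero on the last four, and the dual
    basis consists of six gaps followed by four coordinates. *)
Definition frame_ok (vs : seq (seq nat)) : bool :=
  let gs := gaps vs in
  let units := map (gap vs) gs in
  [&& (size vs == 10%N) && uniq vs,
      all (fun b => (size b == 10%N) && all (fun x => x <= 1)%N b) vs,
      all (fun j => lead vs (term j) \in term j) final_terms,
      all (fun g => all (fun b => pairing b g.1 <= pairing b g.2)%N vs
                    && (drop 6 (gap vs g) == nseq 4 0%N)) gs,
      all (fun k => delta k \in units) (iota 0 6)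
    & all (fun k => has (fun c => [seq nth 0%N b c | b <- vs] == delta k)
                        (iota 0 10)) (iota 6 4)].

Section Frames.
Variable R : realType.
Notation vect := 'rV[R]_10.
Implicit Types (v : vect) (m : tmono) (vs : seq (seq nat)).

Definition mono_form m : vect := \sum_(x <- m) coord_form R (inord x).

Lemma mono_formE m v : lform (mono_form m) v = mono_val m v.
Proof.
rewrite /mono_form /mono_val; elim/big_rec2: _ => [|x y Q _ <-].
  by rewrite lformC lform0r.
by rewrite lformDl coord_formE.
Qed.

Definition frac_form (L : nat -> tmono) (c : frac) : vect :=
  \sum_(j <- c.1) mono_form (L j) - \sum_(j <- c.2) mono_form (L j).

(** The linear map obtained from R when the term j is replaced by its monomial
    L j. *)
Definition lusztig_forms (L : nat -> tmono) (k : 'I_10) : vect :=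
  frac_form L (nth ([::], [::]) lusztig_fracs k).

Lemma frac_formE L c v : lform (frac_form L c) v =
  \sum_(j <- c.1) mono_val (L j) v - \sum_(j <- c.2) mono_val (L j) v.
Proof.
have sumE s : lform (\sum_(j <- s) mono_form (L j)) v =
              \sum_(j <- s) mono_val (L j) v.
  elim/big_rec2: _ => [|x y Q _ <-]; first by rewrite lformC lform0r.
  by rewrite lformDl mono_formE.
by rewrite /frac_form -scaleN1r lformDl lformZl mulN1r !sumE.
Qed.

(** The coordinates of R determine the six nonlinear terms, so R agrees with the
    linear map only where each of these terms equals its chosen monomial. *)
Lemma lusztig_linearP (L : nat -> tmono) v :
  (forall k, (k < 10)%N -> L k = [:: k]) ->
  lusztig v = form_map (lusztig_forms L) v <->
  {in final_terms, forall j, term_val v j = mono_val (L j) v}.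
Proof.
move=> L10.
have xE k : (k < 10)%N -> term_val v k = mono_val (L k) v.
  move=> k10; rewrite (term_val_coord v (Ordinal k10)) L10// /mono_val big_seq1.
  by congr (v 0 _); apply: val_inj; rewrite /= inordK.
have LE (k : 'I_10) : (lusztig v 0 k = form_map (lusztig_forms L) v 0 k) =
    let c := nth ([::], [::]) lusztig_fracs k in
    (\sum_(j <- c.1) term_val v j - \sum_(j <- c.2) term_val v j =
    \sum_(j <- c.1) mono_val (L j) v - \sum_(j <- c.2) mono_val (L j) v).
  by rewrite lusztigE mxE frac_formE.
split=> [RA|trE].
  (* Coordinates 0, 1, 2, 3, 5 and 6 already form a triangular system in the
     six differences term_val v j - mono_val (L j) v. *)
  have eqn k (k10 : (k < 10)%N) :=
    congr1 (fun w : vect => w 0 (Ordinal k10)) RA.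
  move: (eqn 0%N isT) (eqn 1%N isT) (eqn 2%N isT).
  move: (eqn 3%N isT) (eqn 5%N isT) (eqn 6%N isT).
  rewrite !LE /= !big_cons !big_nil !(xE 2%N isT, xE 3%N isT, xE 4%N isT,
    xE 5%N isT, xE 6%N isT, xE 7%N isT, xE 8%N isT, xE 9%N isT).
  move=> e3 e5 e6 e0 e1 e2 j; rewrite !inE.
  by do 5?case/predU1P => [->|]; try move=> /eqP ->; lra.
apply/rowP => k; rewrite LE /=.
have ok : all (fun c => all (fun j => (j < 10) || (j \in final_terms))%N
                            (c.1 ++ c.2)) lusztig_fracs by [].
set c := nth _ _ _.
have /allP c_ok : all (fun j => (j < 10) || (j \in final_terms))%N (c.1 ++ c.2).
  by apply: (allP ok); rewrite mem_nth.
by congr (_ - _); apply: eq_big_seq => j jc; have := c_ok j;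
  rewrite mem_cat jc ?orbT => /(_ isT)/orP[/xE|/trE].
Qed.

Lemma terms_lt10 j m : m \in term j -> all (fun x => x < 10)%N m.
Proof.
have /allP ok : all (all (all (fun x => x < 10)%N)) terms by vm_compute.
rewrite /term; have [jlt|?] := ltnP j (size terms); last first.
  by rewrite nth_default.
by move=> mj; have /ok/allP/(_ _ mj) := mem_nth [::] jlt.
Qed.

Lemma mono_val_pairing m b : all (fun x => x < 10)%N m ->
  mono_val m (vect_of R b) = (pairing b m)%:R.
Proof.
rewrite /mono_val /pairing; elim: m => [|x m IH] /=; first by rewrite big_nil.
by move=> /andP[x10 /IH]; rewrite big_cons natrD mxE inordK// => ->.
Qed.

(** By [lusztig_linearP] the set where R agrees with the map given by the
    leading monomials is the cone where all gaps are nonnegative.  The gaps are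
    nonnegative combinations of the six that belong to the dual basis. *)
Lemma frame_okP vs : frame_ok vs ->
  exists q, dual_to q (fun k => vect_of R (nth [::] vs k)) /\
            simplicial_region (cone q).
Proof.
case/and5P=> [/andP[/eqP vs10 _] _ /allP leadP /allP gapP].
move=> /andP[/allP ess /allP coords].
pose b (k : 'I_10) := vect_of R (nth [::] vs k).
have vsb (k : 'I_10) : nth [::] vs k \in vs by rewrite mem_nth ?vs10.
have nth_vs (T : Type) (x0 : T) (f : seq nat -> T) (k : 'I_10) :
    nth x0 (map f vs) k = f (nth [::] vs k).
  by rewrite (nth_map [::]) ?vs10.
have nth_delta (k j : 'I_10) : nth 0%N (delta k) j = (k == j).
  by rewrite (nth_map 0%N) ?size_iota// nth_iota.
have gap_lt10 g : g \in gaps vs ->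
    all (fun x => x < 10)%N g.1 /\ all (fun x => x < 10)%N g.2.
  case/allpairsPdep => j [m [jm mj ->]] /=.
  by split; apply: (@terms_lt10 j) => //; exact: leadP.
pose gap_form (g : tmono * tmono) := mono_form g.2 - mono_form g.1.
have gap_formE g v : lform (gap_form g) v = mono_val g.2 v - mono_val g.1 v.
  by rewrite /gap_form -scaleN1r lformDl lformZl mulN1r !mono_formE.
have gap_formb g k : g \in gaps vs ->
    lform (gap_form g) (b k) = (nth 0%N (gap vs g) k)%:R.
  move=> gvs; have [lt1 lt2] := gap_lt10 g gvs.
  rewrite gap_formE !mono_val_pairing// nth_vs natrB//.
  by have /andP[/allP/(_ _ (vsb k))] := gapP g gvs.
have /choice[q qP] (k : 'I_10) : exists Q : vect,
    [/\ forall j, lform Q (b j) = (k == j)%:R,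
        (k < 6)%N -> exists2 g, g \in gaps vs & Q = gap_form g
      & (6 <= k)%N -> exists c, Q = coord_form R c].
  have [k6|k6] := ltnP k 6.
    have /mapP[g gvs gE] : delta k \in map (gap vs) (gaps vs).
      by apply: ess; rewrite mem_iota.
    exists (gap_form g); split=> //; last by exists g.
    by move=> j; rewrite gap_formb// -gE nth_delta.
  have /coords/hasP[c] : val k \in iota 6 4 by rewrite mem_iota k6 ltn_ord.
  rewrite mem_iota => c10 /eqP cE; exists (coord_form R (inord c)).
  split=> //; last by exists (inord c).
  by move=> j; rewrite coord_formE mxE inordK// -nth_delta -cE nth_vs.
have qb : dual_to q b by move=> j k; have [-> _ _] := qP j.
exists q; split=> //.
pose L j := if (j < 10)%N then [:: j] else lead vs (term j).
have L10 j : (j < 10)%N -> L j = [:: j] by rewrite /L => ->.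
have LE j : j \in final_terms -> L j = lead vs (term j).
  by rewrite !inE; do 5?case/predU1P => [->//|]; move/eqP => ->.
apply: (cone_simplicial (b := b) (a := lusztig_forms L)) => //.
- by move=> k x; rewrite mxE ler0n.
- apply/seteqP; split=> v /=.
    move=> vA k k6; have trE := (lusztig_linearP v L10).1 vA.
    have [_ /(_ k6)[g gvs ->] _] := qP k; rewrite gap_formE.
    case/allpairsPdep: gvs => j [m [jm mj ->]] /=.
    by rewrite subr_ge0 -LE// -trE//; exact: trop_le.
  move=> vE; apply/(lusztig_linearP v L10).
  move=> j jm; rewrite LE//; apply: trop_unique.
    by exists (lead vs (term j)) => //; exact: leadP.
  (* Expand v in the ten vectors: each gap is nonnegative on the first six and
     zero on the last four, where the coefficients of v have no sign. *)
  move=> m mj; have gvs : (lead vs (term j), m) \in gaps vs.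
    by apply/allpairsPdep; exists j, m.
  rewrite -subr_ge0 -(gap_formE (_, _)) (dual_expand v qb) lform_sumr.
  apply: sumr_ge0 => k _; rewrite lformZr gap_formb//.
  have [k6|k6] := ltnP k 6; first by rewrite mulr_ge0 ?ler0n// vE.
  have /andP[_ /eqP gE] := gapP _ gvs.
  have := nth_drop 6 0%N (gap vs (lead vs (term j), m)) (k - 6).
  by rewrite subnKC// gE nth_nseq if_same => <-; rewrite mulr0.
- by move=> k k6; have [_ _ /(_ k6)] := qP k.
Qed.
End Frames.

(** * Reduced expressions of the longest element *)

Definition swap_label (p m : nat) : nat :=
  if m == p then p.+1 else if m == p.+1 then p else m.

(** The permutation of the labels, computed without passing through 'S_5. *)
Definition act (i : word) (m : nat) : nat := foldr swap_label m i.

Definition letters : seq nat := iota 1 4.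
Definition labels : seq nat := iota 1 5.

Lemma swap_labelK p : involutive (swap_label p).
Proof.
rewrite /swap_label => m; case: (eqVneq m p) => [->|mp].
  by rewrite eqxx -[p.+1]addn1 -{2}[p]addn0 eqn_add2l.
by case: (eqVneq m p.+1) => [->|mp1]; rewrite ?eqxx// (negPf mp) (negPf mp1).
Qed.

Lemma swap_label_labels p m : p \in letters -> m \in labels ->
  swap_label p m \in labels /\ on_label (simple_refl p) m = swap_label p m.
Proof.
rewrite !mem_iota => /andP[p0 p5] /andP[m0 m6]; split.
  by rewrite /swap_label; case: eqP => [|_]; [|case: eqP => _]; lia.
have mE : (inord m.-1 : 'I_5) = m.-1 :> nat by rewrite inordK; lia.
have pE : (inord p : 'I_5) = p :> nat by rewrite inordK; lia.
have p1E : (inord p.-1 : 'I_5) = p.-1 :> nat by rewrite inordK; lia.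
rewrite /on_label /simple_refl /swap_label.
case: tpermP => [/(congr1 val)|/(congr1 val)|/eqP + /eqP];
  rewrite -?val_eqE /= ?mE ?pE ?p1E.
- by move=> mp; rewrite ifT; lia.
- by move=> mp; rewrite ifF ?ifT; lia.
- by move=> mp mp1; rewrite !ifF; lia.
Qed.

Lemma on_labelE i m : all [in letters] i -> m \in labels ->
  act i m \in labels /\ on_label (word_perm i) m = act i m.
Proof.
move=> + ml; elim: i => [_|p i IH] /=.
  split=> //; rewrite /on_label /word_perm big_nil perm1.
  by move: ml; rewrite mem_iota => ?; rewrite inordK; lia.
move=> /andP[pl /IH[il iE]]; rewrite on_label_word_perm_cons iE.
exact: swap_label_labels.
Qed.

Definition reducedb (i : word) : bool :=
  [&& size i == 10%N, all [in letters] i & map (act i) labels == rev labels].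

Lemma reduced_expressionW i : reduced_expression i -> reducedb i.
Proof.
move=> [i10 il iw0].
have {}il : all [in letters] i.
  by apply: sub_all il => p /=; rewrite mem_iota.
rewrite /reducedb i10 il eqxx /=; apply/eqP.
transitivity (map (on_label w0) labels).
  apply/esym/eq_in_map => m ml; rewrite -iw0.
  by have [] := on_labelE il ml.
have w0E m : on_label w0 m.+1 = (5 - (inord m : 'I_5))%N.
  by rewrite /on_label permE /=; have := ltn_ord (inord m : 'I_5); lia.
by rewrite /labels /= !w0E !inordK.
Qed.

(** The label sequences that some n letters turn into the reversed one. *)
Fixpoint completions (n : nat) : seq (seq nat) :=
  if n is n'.+1 then
    let T := completions n' in
    undup [seq map (swap_label p) s | p <- letters, s <- T]
  else [:: rev labels].

(** Words of length n, with their label sequences, that extend on the left to a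
    word of length 10 for the longest element.  Pruning by [completions] makes
    the enumeration complete by construction and small enough to compute. *)
Fixpoint suffixes (n : nat) : seq (word * seq nat) :=
  if n is n'.+1 then
    let T := completions (10 - n) in
    let S := suffixes n' in
    flatten [seq [seq (p :: c.1, map (swap_label p) c.2) |
                   c <- S & map (swap_label p) c.2 \in T] | p <- letters]
  else [:: ([::], labels)].

Definition reduced_words : seq word := map fst (suffixes 10).

Lemma act_cat u w m : act (u ++ w) m = act u (act w m).
Proof. by rewrite /act foldr_cat. Qed.

Lemma completionsP u s : all [in letters] u -> map (act u) s = rev labels ->
  s \in completions (size u).
Proof.
elim/last_ind: u s => [|u p IH] s.
  move=> _; rewrite (eq_map (_ : act [::] =1 id)) // map_id => ->.
  by rewrite mem_head.
rewrite all_rcons size_rcons => /andP[pl ul] us.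
rewrite (_ : completions _ = undup [seq map (swap_label q) t |
           q <- letters, t <- completions (size u)]) // mem_undup.
apply/flattenP.
exists [seq map (swap_label p) t | t <- completions (size u)].
  by apply/mapP; exists p.
apply/mapP; exists (map (swap_label p) s); last first.
  by rewrite -map_comp (eq_map (swap_labelK p)) map_id.
apply: IH => //; rewrite -us -map_comp; apply: eq_map => m /=.
by rewrite -cats1 act_cat.
Qed.

Lemma suffixesP u w : reducedb (u ++ w) ->
  (w, map (act w) labels) \in suffixes (size w).
Proof.
elim: w u => [//|p w IH] u uw.
have /IH wS : reducedb (rcons u p ++ w) by rewrite cat_rcons.
case/and3P: uw; rewrite size_cat all_cat.
move=> /eqP uw10 /andP[ul /andP[pl wl]] /eqP uwE.
apply/flattenP; exists [seq (p :: c.1, map (swap_label p) c.2) |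
  c <- suffixes (size w) &
    map (swap_label p) c.2 \in completions (10 - (size w).+1)].
  by apply/mapP; exists p.
apply/mapP; exists (w, map (act w) labels); last by [].
rewrite mem_filter wS andbT.
rewrite (_ : 10 - (size w).+1 = size u)%N; last by rewrite -uw10 addnK.
by apply: completionsP => //; rewrite -uwE /labels /= !act_cat.
Qed.

Lemma mem_reduced_words i : reducedb i -> i \in reduced_words.
Proof.
move=> ib; have /(map_f fst) := @suffixesP [::] i ib.
by case/and3P: ib => /eqP ->.
Qed.

(** * Chamber sets and partial quivers *)

Definition chamber (i : word) (s : nat) : seq nat :=
  [seq act (take s.+1 i) m | m <- iota (nth 0 i s).+1 (5 - nth 0 i s)]%N.

Definition chambers (i : word) : seq (seq nat) :=
  [seq chamber i s | s <- iota 0 10 & nth 0 i s \in drop s.+1 i]%N.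

Lemma eq_set_mem (T : choiceType) (s t : seq T) :
  [set` s] = [set` t] <-> s =i t.
Proof.
split=> [st x|st]; last by apply/seteqP; split=> x /=; rewrite st.
have xst : (x \in s : Prop) = (x \in t : Prop) := congr1 (fun A => A x) st.
by apply/idP/idP => xs; [rewrite -xst|rewrite xst].
Qed.

Lemma chamberE i s : reducedb i -> (s < 10)%N ->
  chamber_set i s = [set` chamber i s].
Proof.
case/and3P=> /eqP i10 il _ s10.
have tl : all [in letters] (take s.+1 i).
  by apply/allP => p /mem_take; exact: (allP il).
have : nth 0%N i s \in letters by apply: (allP il); rewrite mem_nth ?i10.
rewrite mem_iota => ps.
have lab m : (nth 0 i s < m <= 5)%N -> m \in labels.
  by rewrite mem_iota => ?; lia.
apply/seteqP; split=> [_ [m /= ms <-]|m /= /mapP[l]].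
  have [_ ->] := on_labelE tl (lab _ ms).
  by apply/mapP; exists m => //; rewrite mem_iota; lia.
rewrite mem_iota => ls ->; have ls' : (nth 0 i s < l <= 5)%N by lia.
by exists l => //; have [_ ->] := on_labelE tl (lab _ ls').
Qed.

(** A chamber set depends only on the first of its two positions, which is any
    position whose letter occurs again. *)
Lemma consecutiveP (i : word) s :
  (exists s', consecutive i s s') <-> nth 0%N i s \in drop s.+1 i.
Proof.
split=> [[s' [/andP[ss s'i] e _]]|].
  rewrite -e (_ : s' = s.+1 + (s' - s.+1))%N; last by lia.
  rewrite -nth_drop mem_nth// size_drop ltn_sub2r//.
  exact: leq_ltn_trans s'i.
set x := nth 0%N i s => xi; pose d := index x (drop s.+1 i).
have dlt : (d < size (drop s.+1 i))%N by rewrite index_mem.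
exists (s.+1 + d)%N; split.
- by move: dlt; rewrite size_drop ltn_subRL leq_addr.
- by rewrite -nth_drop nth_index.
move=> r rs; rewrite (_ : r = s.+1 + (r - s.+1))%N; last by lia.
rewrite -nth_drop => /eqP; apply/negP.
have rd : (r - s.+1 < d)%N by lia.
by have := before_find 0%N rd; rewrite /= => ->.
Qed.

Lemma is_chamber_setE i S : reducedb i ->
  is_chamber_set i S <-> exists2 c, c \in chambers i & S = [set` c].
Proof.
move=> ib; have /and3P[/eqP i10 _ _] := ib; split.
  move=> [s [s' [ss ->]]]; have [/andP[lt lt'] _ _] := ss.
  have s10 : (s < 10)%N by lia.
  exists (chamber i s); last exact: chamberE.
  apply: map_f; rewrite mem_filter mem_iota /= s10 andbT.
  by apply/consecutiveP; exists s'.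
move=> [_ /mapP[s + ->] ->]; rewrite mem_filter mem_iota /=.
move=> /andP[/consecutiveP[s' ss] s10]; exists s, s'; split=> //.
by rewrite chamberE.
Qed.

Definition is_L a := if a is aL then true else false.
Definition is_R a := if a is aR then true else false.
Definition is_N a := if a is aN then true else false.

(** Listed in increasing order, that is, from right to left in the diagram: the
    head is the rightmost directed edge. *)
Definition dirs (P : quiver) : seq nat :=
  [seq e <- [:: 2; 3; 4] | ~~ is_N (edge P e)]%N.

Definition quiver_labels (P : quiver) : seq nat :=
  let r := head 0%N (dirs P) in let l := last 0%N (dirs P) in
  [seq e <- [:: 2; 3; 4]%N | is_L (edge P e)]
  ++ (if is_R (edge P r) then iota 1 r.-1 else [::])
  ++ (if is_R (edge P l) then iota l.+1 (5 - l) else [::]).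

Lemma directedE P e : directed P e <-> e \in dirs P.
Proof.
rewrite mem_filter /directed; split; last by case: (edge P e) => // /andP[].
case: P e => [[a b] c] [|[|[|[|[|e]]]]] /= eP; try by case: eP.
all: by rewrite andbT; move: eP; case: a; case: b; case: c.
Qed.

Lemma dirs_sorted P : sorted leq (dirs P).
Proof. exact: (sorted_filter leq_trans). Qed.

Lemma rightmostE P e :
  rightmost P e <-> dirs P != [::] /\ e = head 0%N (dirs P).
Proof.
rewrite /rightmost; have := dirs_sorted P; have := @directedE P.
case: (dirs P) => [|d D] /= DE dD; split=> [] [].
- by move=> /DE.
- by [].
- move=> /DE; rewrite inE => /predU1P[-> _ //|eD] /(_ d).
  have /allP/(_ e eD) de := order_path_min leq_trans dD.
  have /DE dP : d \in d :: D by rewrite mem_head.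
  by move=> /(_ dP) ed; split=> //; apply/eqP; rewrite eqn_leq ed.
- move=> _ ->; split=> [|f /DE]; first by apply/DE; rewrite mem_head.
  rewrite inE => /predU1P[-> //|].
  by apply/allP; exact: order_path_min leq_trans dD.
Qed.

Lemma path_le_last x (s : seq nat) y :
  path leq x s -> y \in x :: s -> (y <= last x s)%N.
Proof.
elim: s x y => [|z s IH] x y /=; first by rewrite inE => _ /eqP ->.
move=> /andP[xz zs]; rewrite inE => /predU1P[->|]; last exact: IH.
by apply: (leq_trans xz); apply: IH => //; exact: mem_head.
Qed.

Lemma leftmostE P e :
  leftmost P e <-> dirs P != [::] /\ e = last 0%N (dirs P).
Proof.
rewrite /leftmost; have := dirs_sorted P; have := @directedE P.
case: (dirs P) => [|d D] /= DE dD; split=> [] [].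
- by move=> /DE.
- by [].
- move=> /DE eD /(_ (last d D)) le; split=> //; apply/eqP.
  by rewrite eqn_leq le ?andbT ?path_le_last//; apply/DE; rewrite mem_last.
- move=> _ ->; split=> [|f /DE]; last exact: path_le_last.
  by apply/DE; rewrite mem_last.
Qed.

Lemma edge_R P e : edge P e = aR <-> is_R (edge P e).
Proof. by case: (edge P e). Qed.

Lemma lsetE P : lset P = [set` quiver_labels P].
Proof.
have D0 e : is_R (edge P e) -> dirs P != [::].
  move=> eR; have /directedE : directed P e; last by case: (dirs P).
  by rewrite /directed => eN; rewrite eN in eR.
suff mP m : lset P m <-> m \in quiver_labels P.
  by apply/seteqP; split=> m /mP.
rewrite !mem_cat mem_filter; split.
  case=> [[|[e [/rightmostE[_ ->] /edge_R -> me]]]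
         |[e [/leftmostE[_ ->] /edge_R -> me]]].
  - by case: P {D0} m => [[a b] c] [|[|[|[|[|m]]]]] //=; rewrite /l1 /= => ->.
  - by rewrite mem_iota; apply/or3P/Or32; lia.
  - by rewrite mem_iota; apply/or3P/Or33; lia.
case/or3P => [/andP[mL _]|+|+].
- by left; left; rewrite /l1/=; case: (edge P m) mL.
- case: ifP => // rR; rewrite mem_iota => me; left; right.
  exists (head 0%N (dirs P)); split; [|exact/edge_R|lia].
  by apply/rightmostE; split=> //; exact: D0 rR.
- case: ifP => // lR; rewrite mem_iota => me; right.
  exists (last 0%N (dirs P)); split; [|exact/edge_R|lia].
  by apply/leftmostE; split=> //; exact: D0 lR.
Qed.

(** The directed edges fail to form a nonempty string only when there are none,
    or when just edges 2 and 4 are directed. *)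
Definition partial_quiverb (P : quiver) : bool :=
  (dirs P != [::]) && (dirs P != [:: 2; 4]%N).

Lemma partial_quiverP P : partial_quiver P <-> partial_quiverb P.
Proof.
rewrite /partial_quiver /partial_quiverb.
split=> [[[e /directedE eD] conn]|/andP[D0 D24]].
  apply/andP; split; first by case: (dirs P) eD.
  apply/eqP => D24; have /directedE : directed P 3.
    by apply: (conn 2%N 3%N 4%N) => //; apply/directedE; rewrite D24.
  by rewrite D24.
split.
  exists (head 0%N (dirs P)); apply/directedE.
  by case: (dirs P) D0 => //= d D; rewrite mem_head.
move=> e f g efg /directedE + /directedE + ; rewrite directedE.
have sub h : h \in dirs P -> h \in [:: 2; 3; 4]%N.
  by rewrite mem_filter => /andP[].
move=> eD gD; have := sub e eD; have := sub g gD; rewrite !inE => g3 e3.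
have [<- //|ef] := eqVneq e f; have [-> //|fg] := eqVneq f g.
have [? ? ?] : [/\ e = 2, f = 3 & g = 4]%N by split; lia.
subst e f g; move: D24 eD gD; rewrite /dirs /=.
by case: (is_N P.2) => //; case: (is_N P.1.2) => //; case: (is_N P.1.1).
Qed.

Definition quivers : seq quiver :=
  let A := [:: aL; aR; aN] in
  [seq P <- [seq (x, c) | x <- [seq (a, b) | a <- A, b <- A], c <- A]
     | partial_quiverb P].

Definition vectors (i : word) : seq (seq nat) :=
  let cs := chambers i in
  [seq quiver_coords P | P <- quivers & has (same_elems (quiver_labels P)) cs]
  ++ extra_coords.

Definition arrow_code a :=
  match a with aL => Some true | aR => Some false | aN => None end.
Definition arrow_decode c :=
  match c with Some true => aL | Some false => aR | None => aN end.

Lemma arrow_codeK : cancel arrow_code arrow_decode. Proof. by case. Qed.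

HB.instance Definition _ := Equality.copy arrow (can_type arrow_codeK).

Lemma mem_quivers P : (P \in quivers) = partial_quiverb P.
Proof. by move: P => [[[] []] []]. Qed.

Lemma vectors_ofE (R : realType) i : reducedb i ->
  vectors_of i = [set vect_of R s | s in [set` vectors i]].
Proof.
move=> ib; apply/seteqP; split=> [_ [[P [pP cP] <-]|[s sE <-]]|_ [s /= + <-]].
- exists (quiver_coords P) => //=.
  rewrite mem_cat; apply/orP; left; apply: map_f.
  rewrite mem_filter mem_quivers; apply/andP; split; last exact/partial_quiverP.
  move/(is_chamber_setE _ ib): cP => [c cc]; rewrite lsetE => /eq_set_mem lc.
  by apply/hasP; exists c => //; exact/same_elemsP.
- by exists s; rewrite //= mem_cat [s \in extra_coords]sE orbT.
rewrite mem_cat => /orP[/mapP[P]|sE]; last by right; exists s.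
rewrite mem_filter mem_quivers => /andP[/hasP[c cc /same_elemsP lc] pP] ->.
left; exists P => //; split; first exact/partial_quiverP.
apply/(is_chamber_setE _ ib); exists c => //.
by rewrite lsetE; exact/eq_set_mem.
Qed.

(** * Moves between reduced expressions *)

(** The swaps are 31 -> 13, 41 -> 14 and 42 -> 24.  No letter is both the first
    of one pair and the second of another, so swaps never overlap and the order
    in which they are made does not matter. *)
Definition sort_step (w : word) : word :=
  let ks := [seq k <- iota 0 9 | comm_at w k && (nth 0 w k.+1 < nth 0 w k)]%N in
  if ks is k :: _ then word_move w k else w.

(** No reduced expression of the longest element needs more than nine swaps. *)
Definition normal_form (w : word) : word := iter 9 sort_step w.

Definition all_but_one (s t : seq (seq nat)) : bool :=
  count [in t] s == (size s).-1.

(** What a move does to the vectors: a commutation preserves them and can be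
    undone, a long braid relation replaces exactly one. *)
Definition moves_ok (w : word) : bool :=
  let vs := vectors w in
  reducedb w && all (fun k =>
    let w' := word_move w k in
    if comm_at w k then
      [&& reducedb w', vectors w' == vs, comm_at w' k & word_move w' k == w]
    else long_at w k ==> reducedb w' && all_but_one vs (vectors w'))
  (iota 0 9).

Lemma all_moves_ok : all moves_ok reduced_words.
Proof. by vm_compute. Qed.

Definition representatives : seq word := undup (map normal_form reduced_words).

Definition long_move_pairs (W : seq word) : seq (word * word) :=
  flatten [seq let r := normal_form w in
    [seq (r, normal_form (word_move w k)) | k <- iota 0 8 & long_at w k]
  | w <- W].

Lemma long_move_pairsP W r r' : (r, r') \in long_move_pairs W ->
  exists w w', [/\ w \in W, long_move w w', r = normal_form w
                 & r' = normal_form w'].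
Proof.
move=> /flattenP[_ /mapP[w wW ->]] /mapP[k]; rewrite mem_filter => /andP[wk _].
by move=> [-> ->]; exists w, (word_move w k); split=> //; exists k.
Qed.

Definition sharing_ok (S : seq word) (E : seq (word * word)) : bool :=
  let vs := [seq (r, vectors r) | r <- S] in
  all (fun r => all (fun r' =>
    if all_but_one r.2 r'.2 then (r.1, r'.1) \in E else true) vs) vs.

(** Stated for arbitrary lists so that applying it never unfolds the list of all
    reduced expressions. *)
Lemma sharing_okP S E r r' : sharing_ok S E -> r \in S -> r' \in S ->
  all_but_one (vectors r) (vectors r') -> (r, r') \in E.
Proof.
move=> /allP ok rS r'S rr'.
have /ok/allP/(_ (r', vectors r')) :
    (r, vectors r) \in [seq (r, vectors r) | r <- S].
  by apply/mapP; exists r.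
by rewrite /= rr'; apply; apply/mapP; exists r'.
Qed.

Lemma representatives_sharing_ok :
  sharing_ok representatives (long_move_pairs reduced_words).
Proof. by vm_compute. Qed.

Lemma all_frame_ok : all (fun r => frame_ok (vectors r)) representatives.
Proof. by vm_compute. Qed.

Lemma comm_move_reduced w w' : reducedb w -> comm_move w w' ->
  [/\ reducedb w', vectors w' = vectors w & comm_move w' w].
Proof.
move=> wb [k wk ->]; have k9 : (k < 9)%N.
  by case/and3P: wb => /eqP w10 _ _; case/andP: wk; rewrite w10.
have /andP[_ /allP/(_ k)] := allP all_moves_ok w (mem_reduced_words wb).
rewrite mem_iota /= => /(_ k9); rewrite wk => /and4P[? /eqP ? ? /eqP wE].
by split=> //; exists k.
Qed.

Lemma long_move_reduced w w' : reducedb w -> long_move w w' ->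
  reducedb w' /\ all_but_one (vectors w) (vectors w').
Proof.
move=> wb [k wk ->]; have k9 : (k < 9)%N.
  case/and3P: wb => /eqP w10 _ _; case/and3P: wk; rewrite w10 => ? _ _; lia.
have /andP[_ /allP/(_ k)] := allP all_moves_ok w (mem_reduced_words wb).
rewrite mem_iota /= => /(_ k9); rewrite wk ifF => [/andP//|].
apply/negP => /andP[_]; case/and3P: wk => _ + _.
rewrite /far /near_by; lia.
Qed.

Lemma comm_class_reduced i w : reducedb i -> comm_class i w ->
  [/\ reducedb w, vectors w = vectors i & comm_class w i].
Proof.
move=> + iw; elim: iw => {i w} [w w' + wb|w wb|u v w _ IHuv _ IHvw ub].
- by move=> /(comm_move_reduced wb)[? ? ?]; split=> //; exact: rt_step.
- by split=> //; exact: rt_refl.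
have [vb vE vu] := IHuv ub; have [wb wE wv] := IHvw vb.
by split=> //; [rewrite wE|exact: rt_trans wv vu].
Qed.

Lemma normal_form_class w : comm_class w (normal_form w).
Proof.
rewrite /normal_form; elim: 9%N => [|n IH]; first exact: rt_refl.
apply: rt_trans IH _; rewrite iterS; move: (iter n _ _) => u.
rewrite /sort_step; case E: [seq _ <- _ | _] => [|k ks]; first exact: rt_refl.
apply: rt_step; exists k => //.
have : k \in k :: ks by rewrite mem_head.
by rewrite -E mem_filter => /andP[/andP[]].
Qed.

Lemma normal_form_representative i : reducedb i ->
  normal_form i \in representatives.
Proof. by move=> ib; rewrite mem_undup; apply/map_f/mem_reduced_words. Qed.

Lemma vectors_normal_form i : reducedb i -> vectors (normal_form i) = vectors i.
Proof.
by move=> ib; have [] := comm_class_reduced ib (normal_form_class i).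
Qed.

Lemma vectors_frame_ok i : reducedb i -> frame_ok (vectors i).
Proof.
move=> ib; rewrite -vectors_normal_form//.
exact: (allP all_frame_ok) (normal_form_representative ib).
Qed.

(** The finite check concerns normal forms only; every word is joined to its
    normal form by commutations in both directions. *)
Lemma share_long_move i i' : reducedb i -> reducedb i' ->
  all_but_one (vectors i) (vectors i') ->
  adjacent_classes (comm_class i) (comm_class i').
Proof.
move=> ib ib'; rewrite -(vectors_normal_form ib) -(vectors_normal_form ib').
move=> /(sharing_okP representatives_sharing_ok (normal_form_representative ib)
           (normal_form_representative ib')).
move=> /long_move_pairsP[w [w' [wW ww' iw i'w']]].
have /andP[wb _] := allP all_moves_ok w wW.
have [wb' _] := long_move_reduced wb ww'.
have path u v : reducedb v -> normal_form u = normal_form v -> comm_class u v.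
  move=> vb uv; have [_ _ vu] := comm_class_reduced vb (normal_form_class v).
  by apply: rt_trans (normal_form_class u) _; rewrite uv.
by exists w, w'; split; [exact: path|exact: path|left].
Qed.

(** * Adjacency *)

Lemma all_but_oneP (s t : seq (seq nat)) : uniq s -> s != [::] ->
  reflect (exists2 x, x \in s & forall y, y \in s -> (y \in t) = (y != x))
          (all_but_one s t).
Proof.
move=> us s0; have cE := count_predC [in t] s.
have s1 : (0 < size s)%N by rewrite lt0n size_eq0.
apply: (iffP eqP) => [c1|[x xs xP]].
  have : count (predC [in t]) s = 1%N.
    by move: cE; rewrite c1 -{2}(prednK s1) -addn1 => /addnI.
  rewrite -size_filter; case F : [seq _ <- _ | _] => [|x [|]] // _.
  have xF : x \in [seq x <- s | predC [in t] x] by rewrite F mem_head.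
  exists x; first by move: xF; rewrite mem_filter => /andP[].
  move=> y ys; have : (y \in [seq x <- s | predC [in t] x]) = (y == x).
    by rewrite F inE.
  by rewrite mem_filter ys andbT /= => <-; rewrite negbK.
have : count (predC [in t]) s = count_mem x s.
  by apply: eq_in_count => y ys /=; rewrite xP// negbK.
by rewrite count_uniq_mem// xs => c1; rewrite -cE c1 addn1.
Qed.

Lemma all_but_one_sym (s t : seq (seq nat)) : uniq s -> uniq t ->
  size s = size t -> all_but_one s t = all_but_one t s.
Proof.
move=> us ut st; rewrite /all_but_one st -!size_filter.
congr (_ == _); apply: perm_size; apply: uniq_perm; rewrite ?filter_uniq//.
by move=> x; rewrite !mem_filter andbC.
Qed.

Lemma adjacent_classesP i i' : reducedb i -> reducedb i' ->
  adjacent_classes (comm_class i) (comm_class i') <->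
  all_but_one (vectors i) (vectors i').
Proof.
move=> ib ib'; split; last exact: share_long_move.
move=> [w [w' [iw iw' ww']]].
have [wb wE _] := comm_class_reduced ib iw.
have [wb' wE' _] := comm_class_reduced ib' iw'.
case: ww' => [/(long_move_reduced wb)[_]|/(long_move_reduced wb')[_]].
  by rewrite wE wE'.
have /and5P[/andP[/eqP si ui] _ _ _ _] := vectors_frame_ok ib.
have /and5P[/andP[/eqP si' ui'] _ _ _ _] := vectors_frame_ok ib'.
by rewrite wE wE' all_but_one_sym// si.
Qed.

(** A region is attached to a reduced expression through its vectors only. *)
Lemma region_of_ext (R : realType) i i' :
  vectors_of (R := R) i = vectors_of i' -> region_of R i = region_of R i'.
Proof.
move=> ii'; rewrite /region_of; congr get; apply/funext => X.
by rewrite /is_region_of /opposite_wall ii'.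
Qed.

Section Adjacency.
Variable R : realType.

Definition frame (vs : seq (seq nat)) (k : 'I_10) : 'rV[R]_10 :=
  vect_of R (nth [::] vs k).

Lemma vect_of_inj (s t : seq nat) : size s = 10%N -> size t = 10%N ->
  vect_of R s = vect_of R t -> s = t.
Proof.
move=> s10 t10 st; apply: (@eq_from_nth _ 0%N) => [|k]; first by rewrite s10.
rewrite s10 => k10; have := congr1 (fun v : 'rV_10 => v 0 (Ordinal k10)) st.
by rewrite !mxE => /eqP; rewrite eqr_nat => /eqP.
Qed.

Lemma adjacent_regionsP i i' : reducedb i -> reducedb i' ->
  adjacent_regions (region_of R i) (region_of R i') <->
  all_but_one (vectors i) (vectors i').
Proof.
move=> ib ib'.
have ok := vectors_frame_ok ib; have ok' := vectors_frame_ok ib'.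
have /and5P[/andP[/eqP si ui] /allP vs01 _ _ _] := ok.
have /and5P[/andP[/eqP si' ui'] /allP vs01' _ _ _] := ok'.
have [q [qb sq]] := frame_okP R ok; have [q' [qb' sq']] := frame_okP R ok'.
have memP w : size (vectors w) = 10%N -> forall x, x \in vectors w ->
    exists k : 'I_10, nth [::] (vectors w) k = x.
  move=> sw x xw; have k10 : (index x (vectors w) < 10)%N.
    by rewrite -sw index_mem.
  by exists (Ordinal k10); exact: nth_index.
have nthP w : size (vectors w) = 10%N -> forall k : 'I_10,
    nth [::] (vectors w) k \in vectors w by move=> sw k; rewrite mem_nth ?sw.
have range w : reducedb w -> size (vectors w) = 10%N ->
    vectors_of w = range (frame (vectors w)).
  move=> wb sw; rewrite vectors_ofE//; apply/seteqP; split=> v [].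
    by move=> x /= /(memP _ sw)[k <-] <-; exists k.
  by move=> k _ <-; exists (nth [::] (vectors w) k) => //; exact: nthP.
have wX := walls_region_of qb (range _ ib si) sq.
have wX' := walls_region_of qb' (range _ ib' si') sq'.
have f01 w :
    {in vectors w, forall b, (size b == 10%N) && all (fun x => x <= 1)%N b} ->
    size (vectors w) = 10%N -> forall k, zero_one (frame (vectors w) k).
  move=> w01 sw k x; rewrite mxE.
  have /andP[/eqP b10 /all_nthP b1] := w01 _ (nthP _ sw k).
  have := b1 0%N x; rewrite b10 => /(_ (ltn_ord x)).
  by case: (nth _ _ x) => [|[|//]] _; [left|right].
have b01 := f01 i vs01 si; have b01' := f01 i' vs01' si'.
have nth_eq (k k' : 'I_10) : frame (vectors i) k = frame (vectors i') k' ->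
    nth [::] (vectors i) k = nth [::] (vectors i') k'.
  apply: vect_of_inj; first by have /andP[/eqP] := vs01 _ (nthP _ si k).
  by have /andP[/eqP] := vs01' _ (nthP _ si' k').
have ne0 w : size (vectors w) = 10%N -> vectors w != [::] by case: (vectors w).
split=> [adj|].
  (* The k-th vector itself is not shared: sharing all ten vectors would make
     the two regions equal. *)
  have [k kP] := adjacent_regions_share qb qb' b01 b01' wX wX' adj.
  apply/(all_but_oneP _ ui (ne0 _ si)).
  exists (nth [::] (vectors i) k); first exact: nthP.
  have others y :
      y \in vectors i -> y != nth [::] (vectors i) k -> y \in vectors i'.
    move=> /(memP _ si)[l <-] lk.
    have [|l' /nth_eq ->] := kP l; last exact: nthP.
    by apply: contra_neq lk => ->.
  move=> y yi; have [->|yk] := eqVneq y; last exact: others.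
  apply/negP => ki'; case: adj => + _; apply; apply: region_of_ext.
  rewrite !vectors_ofE//; congr image; apply/eq_set_mem.
  have sub : {subset vectors i <= vectors i'}.
    move=> z zi; have [->//|] := eqVneq z (nth [::] (vectors i) k).
    exact: others.
  by have [] := uniq_min_size ui sub; rewrite ?si ?si'.
move=> ii'; have i'i := ii'; rewrite all_but_one_sym ?si// in i'i.
have /(all_but_oneP _ ui (ne0 _ si))[x /(memP _ si)[k <-] kP] := ii'.
have /(all_but_oneP _ ui' (ne0 _ si'))[x' /(memP _ si')[k' <-] kP'] := i'i.
have nth_neq (s : seq (seq nat)) (j l : 'I_10) : uniq s -> size s = 10%N ->
    (nth [::] s j != nth [::] s l) = (j != l).
  by move=> us s10; rewrite nth_uniq ?s10.
apply: (share_adjacent_regions qb qb' b01 b01' wX wX' (k := k) (k' := k')).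
- move=> j jk; have := kP _ (nthP _ si j).
  rewrite nth_neq// jk => ji'; have [j' j'E] := memP _ si' _ ji'.
  exists j'; last by rewrite /frame j'E.
  by rewrite -(nth_neq _ _ _ ui' si') -kP' ?nthP// j'E nthP.
- move=> j' jk'; have := kP' _ (nthP _ si' j').
  rewrite nth_neq// jk' => ji; have [j jE] := memP _ si _ ji.
  exists j; last by rewrite /frame jE.
  by rewrite -(nth_neq _ _ _ ui si) -kP ?nthP// jE nthP.
- move=> j' /nth_eq kj'; have := kP _ (nthP _ si k).
  by rewrite eqxx kj' nthP.
Qed.

End Adjacency.

Theorem proposition7p2 (R : realType) (i i' : word)
  (hi : reduced_expression i) (hi' : reduced_expression i') :
  adjacent_classes (comm_class i) (comm_class i') <->
  adjacent_regions (region_of R i) (region_of R i').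
Proof.
have ib := reduced_expressionW hi; have ib' := reduced_expressionW hi'.
by rewrite adjacent_classesP// adjacent_regionsP.
Qed.
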